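(* Let $R$ be a standard graded polynomial ring over a field $\mathbb{K}$. Let $\Lambda$ be a nonempty finite poset and let $\{u_\lambda : \lambda\in\Lambda\}\subseteq R$ be a quadratic sequence consisting of nonzero homogeneous elements of positive degree. Then for all $s\geq 1$, \[\operatorname{reg}(R/U_\Lambda^s)\leq d(s-1)+\max_{\Sigma,\lambda}\operatorname{reg}\bigl(R/((U_\Sigma:u_\lambda)+U_\Lambda)\bigr),\] where the maximum is over all pairs $(\Sigma,\lambda)$ with $\Sigma$ a poset ideal of $\Lambda$ and $\lambda\in\Lambda$ lying inside or just above $\Sigma$, and $d=\max\{\deg(u_\lambda):\lambda\in\Lambda\}$.
   Context: Let $\Lambda$ be a finite poset. A subset $\Sigma\subseteq\Lambda$ (possibly empty) is a poset ideal if $\sigma\in\Sigma$, $\lambda\in\Lambda$ and $\lambda\leq\sigma$ imply $\lambda\in\Sigma$. For a poset ideal $\Sigma$, an element $\lambda\in\Lambda$ lies just above $\Sigma$ if $\lambda\notin\Sigma$ and every $\sigma\in\Lambda$ with $\sigma<\lambda$ belongs to $\Sigma$; $\lambda$ lies inside or just above $\Sigma$ if $\lambda\in\Sigma$ or $\lambda$ lies just above $\Sigma$. Given elements $u_\lambda$ ($\lambda\in\Lambda$) of a commutative Noetherian ring $R$ and $\Sigma\subseteq\Lambda$, $U_\Sigma$ denotes the ideal generated by $\{u_\sigma:\sigma\in\Sigma\}$, with $U_\emptyset=(0)$. The set $\{u_\lambda:\lambda\in\Lambda\}$ is a quadratic sequence if for every pair $(\Sigma,\lambda)$, where $\Sigma$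 is a poset ideal of $\Lambda$ and $\lambda$ lies inside or just above $\Sigma$, there exists a poset ideal $\Theta$ of $\Lambda$ such that (1) $(U_\Sigma:u_\lambda)\cap U_\Lambda\subseteq U_\Theta$, and (2) $u_\lambda U_\Theta\subseteq U_\Sigma U_\Lambda$. $\operatorname{reg}$ denotes Castelnuovo–Mumford regularity, with $\operatorname{reg}(0)=-\infty$. *)

(* Defs.v *)
From HB Require Import structures.
From mathcomp Require Import all_boot all_order all_algebra.
From mathcomp Require Import mpoly.
From mathcomp Require Import classical_sets constructive_ereal.

Set Implicit Arguments.
Unset Strict Implicit.
Unset Printing Implicit Defensive.

Import Order.TTheory GRing.Theory Num.Theory.
Local Open Scope classical_set_scope.
Local Open Scope ring_scope.

Section Ideals.
Variable R : comNzRingType.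
Implicit Types (I J S : set R) (x : R).

(* The improper ideal is allowed, unlike in [idealr_closed]. *)
Definition is_ideal I : Prop :=
  [/\ I 0, forall x y, I x -> I y -> I (x + y)
     & forall a x, I x -> I (a * x)].

Definition ideal_gen S : set R := smallest is_ideal S.

Definition ideal_add I J : set R :=
  [set z | exists x y, [/\ I x, J y & z = x + y]].

Definition ideal_mul I J : set R :=
  ideal_gen [set z | exists x y, [/\ I x, J y & z = x * y]].

Fixpoint ideal_exp I (s : nat) : set R :=
  if s is s'.+1 then ideal_mul I (ideal_exp I s') else setT.

Definition ideal_colon I x : set R := [set y | I (y * x)].

End Ideals.

Section PosetIdeals.
Context {disp : Order.disp_t} {L : finPOrderType disp}.
Implicit Types (Sigma : {set L}) (l : L).

Definition poset_ideal Sigma : bool :=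
  [forall s in Sigma, forall l, (l <= s)%O ==> (l \in Sigma)].

Definition just_above Sigma l : bool :=
  (l \notin Sigma) && [forall s, (s < l)%O ==> (s \in Sigma)].

Definition inside_or_just_above Sigma l : bool :=
  (l \in Sigma) || just_above Sigma l.

End PosetIdeals.

Section QuadraticSequence.
Context {disp : Order.disp_t} {L : finPOrderType disp} {R : comNzRingType}.
Implicit Types (u : L -> R) (Sigma : {set L}).

Definition U_ u Sigma : set R :=
  ideal_gen [set x | exists2 l, l \in Sigma & x = u l].

Definition quadratic_sequence u : Prop :=
  forall (Sigma : {set L}) (l : L),
    poset_ideal Sigma -> inside_or_just_above Sigma l ->
    exists Theta : {set L},
      [/\ poset_ideal Theta,
          ideal_colon (U_ u Sigma) (u l) `&` U_ u finset.setT `<=` U_ u Theta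
        & forall x, U_ u Theta x ->
            ideal_mul (U_ u Sigma) (U_ u finset.setT) (u l * x)].

End QuadraticSequence.

Section Regularity.
Variables (K : fieldType) (n : nat).
Local Notation R := {mpoly K[n]}.

(* Graded homomorphisms (of degree 0) ... -> F_2 -> F_1 -> F_0 -> R between
   graded free modules of finite rank: F_i is free on rk i generators, the k-th
   one having degree gdeg i k.  Elements of F_i are row vectors and maps act by
   multiplication on the right; dif i is the map F_(i+1) -> F_i and aug the map
   F_0 -> R.  The conditions on monomials say that the entries are homogeneous
   of the degrees making the maps homogeneous of degree 0 (an entry is zero if
   its expected degree is negative). *)
Record graded_free_sequence := GradedFreeSequence {
  rk : nat -> nat;
  gdeg : forall i, 'I_(rk i) -> int;
  aug : 'cV[R]_(rk 0);
  dif : forall i, 'M[R]_(rk i.+1, rk i);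
  aug_homog : forall k m, m \in msupp (aug k 0) -> (mdeg m)%:Z = gdeg k;
  dif_homog : forall i k l m, m \in msupp (dif i k l) ->
    gdeg l + (mdeg m)%:Z = gdeg k
}.
Arguments gdeg : clear implicits.

(* Minimality: all entries of the differentials lie in the irrelevant maximal
   ideal, i.e. have zero constant term. *)
Definition minimal_free_resolution (I : set R) (F : graded_free_sequence) :
    Prop :=
  [/\ forall p, exists v : 'rV_(rk F 0), I (p - (v *m aug F) 0 0),
      forall v : 'rV_(rk F 0),
        I ((v *m aug F) 0 0) <-> exists w, v = w *m dif F 0,
      forall i (v : 'rV_(rk F i.+1)),
        v *m dif F i = 0 <-> exists w, v = w *m dif F i.+1
    & forall i k l, (dif F i k l)@_(0%MM) = 0].

(* Castelnuovo-Mumford regularity of the graded module R/I, for a homogeneous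
   ideal I: the supremum of j - i over the pairs (i, j) such that the i-th
   module of the minimal graded free resolution of R/I (which is unique up to
   isomorphism) has a generator of degree j.  The supremum over the empty set,
   i.e. the regularity of the zero module, is -oo. *)
Definition reg_quotient (I : set R) : \bar int :=
  supremum -oo%E
    [set r | exists F i (k : 'I_(rk F i)),
       minimal_free_resolution I F /\ r = (gdeg F i k - i%:Z)%:E].

(* Total degree; mpoly's msize is one more than the degree for p != 0. *)
Definition poly_degree (p : R) : nat := (msize p).-1.

End Regularity.

(* Main.v *)
(* Let U be the ideal generated by all the u_l. Descending through poset ideals
   shows that U_Sigma and U^(k+1) intersect in U_Sigma U^k. Hence, for l just
   above Sigma, the elements of U^k multiplied by u_l into U_Sigma U^k + U^(k+2)
   form the ideal (U_Sigma : u_l) + U if k = 0, and U_Theta U^(k-1) + U^(k+1),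
   for some poset ideal Theta, if k > 0. So U^k / U^(k+1) has a filtration with
   quotients R / ((U_Sigma : u_l) + U), each shifted by the degree of a product
   of k of the u_l, and R / U itself is the case where Sigma is empty and l is
   minimal, as R is a domain. Regularity bounds pass through extensions by the
   horseshoe lemma, used for resolutions of subquotients A/B of R. Such
   resolutions need not be minimal: the minimal resolution of R/I maps to any
   other one and back, by a map homotopic to the identity, so that the degrees
   of its generators occur in the other one too. To read resolutions off the
   right-hand side, one also needs the existence of minimal free resolutions,
   which rests on Dickson's lemma. *)
From HB Require Import structures.
Require Import Defs.
From mathcomp Require Import all_boot all_order all_algebra.
From mathcomp Require Import mpoly.
From mathcomp Require Import boolp classical_sets constructive_ereal.
From mathcomp Require Import ring zify.

Set Implicit Arguments.
Unset Strict Implicit.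
Unset Printing Implicit Defensive.

Import Order.TTheory GRing.Theory Num.Theory.
Local Open Scope classical_set_scope.
Local Open Scope ring_scope.

(** * Ideals and quadratic sequences *)

Section IdealTheory.
Variable R : comNzRingType.
Implicit Types (I J H S : set R) (x y : R).

Lemma is_ideal0 I : is_ideal I -> I 0. Proof. by case. Qed.

Lemma is_idealD I x y : is_ideal I -> I x -> I y -> I (x + y).
Proof. by case=> _ h _; apply: h. Qed.

Lemma is_idealM I a x : is_ideal I -> I x -> I (a * x).
Proof. by case=> _ _ h; apply: h. Qed.

Lemma is_idealMr I a x : is_ideal I -> I x -> I (x * a).
Proof. by rewrite mulrC; apply: is_idealM. Qed.

Lemma is_idealN I x : is_ideal I -> I x -> I (- x).
Proof. by move=> hI Ix; rewrite -mulN1r; apply: is_idealM. Qed.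

Lemma is_idealB I x y : is_ideal I -> I x -> I y -> I (x - y).
Proof. by move=> hI Ix Iy; apply: is_idealD => //; apply: is_idealN. Qed.

Lemma is_ideal_sum I (T : Type) (r : seq T) (P : pred T) (F : T -> R) :
  is_ideal I -> (forall i, P i -> I (F i)) -> I (\sum_(i <- r | P i) F i).
Proof.
move=> hI hF; elim/big_ind: _ => //; first exact: is_ideal0.
by move=> x y; apply: is_idealD.
Qed.

Lemma is_ideal_gen S : is_ideal (ideal_gen S).
Proof.
split=> [|x y hx hy|a x hx] J [hJ sJ].
- exact: is_ideal0.
- by apply: is_idealD; [|apply: hx|apply: hy].
- by apply: is_idealM; [|apply: hx].
Qed.

Lemma ideal_gen_mem S x : S x -> ideal_gen S x.
Proof. by move=> Sx J [_]; apply. Qed.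

Lemma ideal_gen_sub S J : is_ideal J -> S `<=` J -> ideal_gen S `<=` J.
Proof. by move=> hJ sJ x; apply. Qed.

Lemma is_ideal_setT : is_ideal (setT : set R). Proof. by split. Qed.

Lemma is_ideal_add I J : is_ideal I -> is_ideal J -> is_ideal (ideal_add I J).
Proof.
move=> hI hJ; split=> [|_ _ [x [y [Ix Jy ->]]] [x' [y' [Ix' Jy' ->]]]|
    a _ [x [y [Ix Jy ->]]]].
- by exists 0, 0; split; [exact: is_ideal0|exact: is_ideal0|rewrite addr0].
- exists (x + x'), (y + y'); split; [exact: is_idealD|exact: is_idealD|].
  by rewrite addrACA.
- by exists (a * x), (a * y); rewrite -mulrDr; split=> //; apply: is_idealM.
Qed.

Lemma ideal_addl I J : is_ideal J -> I `<=` ideal_add I J.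
Proof. by move=> hJ x Ix; exists x, 0; rewrite addr0; split=> //; case: hJ. Qed.

Lemma ideal_addr I J : is_ideal I -> J `<=` ideal_add I J.
Proof. by move=> hI x Jx; exists 0, x; rewrite add0r; split=> //; case: hI. Qed.

Lemma ideal_add_sub I J H : is_ideal H -> I `<=` H -> J `<=` H ->
  ideal_add I J `<=` H.
Proof.
move=> hH sI sJ _ [x [y [Ix Jy ->]]].
by apply: is_idealD => //; [apply: sI|apply: sJ].
Qed.

Lemma is_ideal_colon I x : is_ideal I -> is_ideal (ideal_colon I x).
Proof.
move=> hI; split=> [|y z hy hz|a y hy]; rewrite /ideal_colon /=.
- by rewrite mul0r; apply: is_ideal0.
- by rewrite mulrDl; apply: is_idealD.
- by rewrite -mulrA; apply: is_idealM.
Qed.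

Lemma is_ideal_mul I J : is_ideal (ideal_mul I J).
Proof. exact: is_ideal_gen. Qed.

Lemma ideal_mul_mem I J x y : I x -> J y -> ideal_mul I J (x * y).
Proof. by move=> Ix Jy; apply: ideal_gen_mem; exists x, y. Qed.

Lemma ideal_mul_sub I J H : is_ideal H ->
  (forall x y, I x -> J y -> H (x * y)) -> ideal_mul I J `<=` H.
Proof.
move=> hH h; apply: ideal_gen_sub => // _ [x [y [Ix Jy ->]]]; exact: h.
Qed.

Lemma ideal_mul_subr I J : is_ideal J -> ideal_mul I J `<=` J.
Proof. by move=> hJ; apply: ideal_mul_sub => // x y _; apply: is_idealM. Qed.

Lemma ideal_mul_subl I J : is_ideal I -> ideal_mul I J `<=` I.
Proof.
by move=> hI; apply: ideal_mul_sub => // x y Ix _; apply: is_idealMr.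
Qed.

Lemma ideal_mulS I I' J J' : I `<=` I' -> J `<=` J' ->
  ideal_mul I J `<=` ideal_mul I' J'.
Proof.
move=> sI sJ; apply: ideal_mul_sub; first exact: is_ideal_mul.
by move=> x y Ix Jy; apply: ideal_mul_mem; [apply: sI|apply: sJ].
Qed.

Lemma is_ideal_exp I k : is_ideal (ideal_exp I k).
Proof. by case: k => [|k]; [exact: is_ideal_setT|exact: is_ideal_mul]. Qed.

Lemma ideal_expS_sub I k : ideal_exp I k.+1 `<=` ideal_exp I k.
Proof. by apply: ideal_mul_subr; apply: is_ideal_exp. Qed.

Lemma ideal_exp1 I : is_ideal I -> ideal_exp I 1 = I.
Proof.
move=> hI; apply/seteqP; split; first exact: ideal_mul_subl.
by move=> x Ix; rewrite -[x]mulr1; apply: ideal_mul_mem.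
Qed.

Lemma ideal_expS_base I k : is_ideal I -> ideal_exp I k.+1 `<=` I.
Proof. by move=> hI; apply: ideal_mul_subl. Qed.

End IdealTheory.
Arguments is_idealM {R I} [a x].
Arguments is_idealMr {R I} [a x].

(** * Poset ideals *)

Section PosetIdealTheory.
Context {disp : Order.disp_t} {L : finPOrderType disp}.
Implicit Types (Sigma : {set L}) (l : L).

Lemma poset_ideal0 : poset_ideal (finset.set0 : {set L}).
Proof. by apply/forall_inP => s; rewrite inE. Qed.

(** An element outside [Sigma] with the fewest elements below it is minimal outside [Sigma]: a
    smaller one would have a strictly smaller down-set. *)
Lemma exists_just_above Sigma :
  Sigma != finset.setT -> exists l, just_above Sigma l.
Proof.
rewrite -finset.subTset => /fintype.subsetPn[l0 _ l0S].
have {}l0S : l0 \in finset.setC Sigma by rewrite inE.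
have [l lS lmin] := @arg_minnP _ l0 (mem (finset.setC Sigma))
  (fun l => #|[set s | (s <= l)%O]%SET|) l0S.
exists l; apply/andP; split; first by move: lS; rewrite /= inE.
apply/forallP => s; apply/implyP => sl; apply: contraT => sS.
have := lmin s; rewrite /= inE sS => /(_ isT); rewrite leqNgt => /negP[].
apply: proper_card; apply/properP; split.
  apply/fintype.subsetP => t; rewrite !inE => ts; exact: (le_trans ts (ltW sl)).
by exists l; rewrite inE ?lexx // lt_geF.
Qed.

Lemma just_above_poset_ideal Sigma l :
  poset_ideal Sigma -> just_above Sigma l -> poset_ideal (l |: Sigma)%SET.
Proof.
move=> /forall_inP hS /andP[_ /forallP hl]; apply/forall_inP => s.
rewrite !inE => /orP[/eqP->|sS]; apply/forallP => t; apply/implyP => ts.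
  rewrite !inE; have [//|tl] := eqVneq t l.
  by apply: (implyP (hl t)); rewrite lt_neqAle tl.
by rewrite !inE (implyP (forallP (hS s sS) t) ts) orbT.
Qed.

(* Poset ideals are reached from the whole poset by removing maximal elements,
   i.e. by going down along pairs (Sigma, l) with l just above Sigma. *)
Lemma poset_ideal_ind (P : {set L} -> Prop) :
  P finset.setT ->
  (forall Sigma l, poset_ideal Sigma -> just_above Sigma l ->
     P (l |: Sigma)%SET -> P Sigma) ->
  forall Sigma, poset_ideal Sigma -> P Sigma.
Proof.
move=> PT Pstep Sigma; have [m] := ubnP #|~: Sigma|%SET.
elim: m Sigma => // m IHm Sigma hm hS.
have [->//|SnT] := eqVneq Sigma finset.setT.
have [l hl] := exists_just_above SnT.
apply: (Pstep _ l) => //; apply: IHm; last exact: just_above_poset_ideal.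
have /andP[lS _] := hl; rewrite -ltnS; apply: leq_trans hm; rewrite ltnS.
apply: proper_card; apply/properP; split.
  by rewrite finset.setCS finset.subsetUr.
by exists l; rewrite !inE ?eqxx ?lS.
Qed.

End PosetIdealTheory.

(** * Intersections and colon ideals of powers of U *)

Section QuadraticSequenceTheory.
Context {disp : Order.disp_t} {L : finPOrderType disp} {R : comNzRingType}.
Variable u : L -> R.
Implicit Types (Sigma Theta : {set L}) (l : L) (x : R).
Local Notation U := (U_ u).
Local Notation UL := (U_ u finset.setT).
Local Notation "I ^^ k" := (ideal_exp I k) (at level 30).
Local Notation "I *i J" := (ideal_mul I J) (at level 40).

Lemma is_ideal_U Sigma : is_ideal (U Sigma).
Proof. exact: is_ideal_gen. Qed.

Lemma U_mem Sigma l : l \in Sigma -> U Sigma (u l).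
Proof. by move=> lS; apply: ideal_gen_mem; exists l. Qed.

Lemma U_subset Sigma Theta : Sigma \subset Theta -> U Sigma `<=` U Theta.
Proof.
move=> /fintype.subsetP h; apply: ideal_gen_sub; first exact: is_ideal_gen.
by move=> _ [l lS ->]; apply: U_mem; apply: h.
Qed.

Lemma U_set0 : U finset.set0 = [set 0].
Proof.
apply/seteqP; split.
  apply: ideal_gen_sub; last by move=> x [l]; rewrite inE.
  split=> // [x y -> ->|a x ->]; first by rewrite addr0.
  by rewrite /= mulr0.
by move=> x ->; apply: is_ideal0; apply: is_ideal_U.
Qed.

Lemma U_mul_subset Sigma Theta J :
  Sigma \subset Theta -> U Sigma *i J `<=` U Theta *i J.
Proof. by move=> h; apply: ideal_mulS => //; apply: U_subset. Qed.

(** As J is an ideal, the coefficients of [u l] are absorbed into J, and the sums on the right form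
    an ideal [H]. For fixed y in J, the t with t y in [H] form an ideal too, so only generators t
    have to be checked. *)
Lemma U_mul_setU1 Sigma l J x : is_ideal J -> (U (l |: Sigma)%SET *i J) x ->
  exists a z, [/\ (U Sigma *i J) a, J z & x = a + u l * z].
Proof.
move=> hJ; pose H := [set x | exists a z,
  [/\ (U Sigma *i J) a, J z & x = a + u l * z]].
have hH : is_ideal H.
  split=> [|_ _ [a [z [ha hz ->]]] [a' [z' [ha' hz' ->]]]|
           b _ [a [z [ha hz ->]]]].
  - exists 0, 0; split; [|exact: is_ideal0|].
      by apply: is_ideal0; apply: is_ideal_mul.
    by rewrite mulr0 addr0.
  - exists (a + a'), (z + z'); split; last by ring.
      exact: (is_idealD (is_ideal_mul _ _)).
    exact: is_idealD.
  - exists (b * a), (b * z); split; last by ring.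
      exact: (is_idealM (is_ideal_mul _ _)).
    exact: is_idealM.
suff: U (l |: Sigma)%SET *i J `<=` H by apply.
apply: ideal_mul_sub => // t y Ut Jy.
suff: U (l |: Sigma)%SET `<=` [set t | H (t * y)] by apply.
apply: ideal_gen_sub => [|_ [l' + ->]].
  split=> [|s s' hs hs'|b s hs] /=.
  - by rewrite mul0r; apply: is_ideal0.
  - by rewrite mulrDl; apply: is_idealD.
  - by rewrite -mulrA; apply: is_idealM.
rewrite !inE => /orP[/eqP->|l'S].
  exists 0, y; split=> //; last by rewrite add0r.
  by apply: is_ideal0; apply: is_ideal_mul.
exists (u l' * y), 0; split; last by rewrite mulr0 addr0.
- by apply: ideal_mul_mem => //; apply: U_mem.
- exact: is_ideal0.
Qed.

Hypothesis u_quadratic : quadratic_sequence u.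

(** This is condition (2) of quadratic sequences, multiplied by U^k. *)
Lemma mul_U_theta Sigma Theta l k x :
  (forall y, U Theta y -> (U Sigma *i UL) (u l * y)) ->
  (U Theta *i UL ^^ k) x -> (U Sigma *i UL ^^ k.+1) (u l * x).
Proof.
move=> hT; set I := U Sigma *i UL ^^ k.+1.
have hI : is_ideal I := is_ideal_mul _ _.
suff: U Theta *i UL ^^ k `<=` [set y | I (u l * y)] by apply.
apply: ideal_mul_sub => [|y z Ty kz /=].
  split=> [|s s' hs hs'|b s hs] /=.
  - by rewrite mulr0; apply: (is_ideal0 hI).
  - by rewrite mulrDr; apply: (is_idealD hI).
  - by rewrite mulrCA; apply: (is_idealM hI).
suff: U Sigma *i UL `<=` ideal_colon I z by rewrite mulrA; apply; exact: hT.
apply: ideal_mul_sub; first exact: is_ideal_colon.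
move=> a b Sa Lb; rewrite /ideal_colon /= -mulrA.
by apply: ideal_mul_mem => //; apply: ideal_mul_mem.
Qed.

(* The intersection is computed by descending from Lambda to Sigma: if u_l z
   lies in U_Sigma, then z lies in U_Theta, hence, by induction on k, in
   U_Theta U^k, which u_l multiplies into U_Sigma U^(k+1). *)
Lemma U_cap_exp k Sigma x : poset_ideal Sigma ->
  U Sigma x -> (UL ^^ k.+1) x -> (U Sigma *i UL ^^ k) x.
Proof.
elim: k Sigma x => [|k IHk] Sigma x hS.
  by move=> Sx _; rewrite -[x]mulr1; apply: ideal_mul_mem.
move: Sigma hS x; pose P S :=
  forall x, U S x -> (UL ^^ k.+2) x -> (U S *i UL ^^ k.+1) x.
(* For the whole poset the claim holds by definition, U^(k+2) being U times U^(k+1). *)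
apply: (@poset_ideal_ind _ _ P) => [x _ //|Sigma l hS hl IH x Sx kx].
have Slx : U (l |: Sigma)%SET x by apply: U_subset Sx; apply: finset.subsetUr.
have [|a [z [ha hz xE]]] := U_mul_setU1 _ (IH x Slx kx).
  exact: is_ideal_exp.
have lS : inside_or_just_above Sigma l by apply/orP; right.
have [Theta [hT T1 T2]] := u_quadratic hS lS.
have Tz : U Theta z.
  apply: T1; split; last exact: (ideal_expS_base (is_ideal_U _) hz).
  rewrite /ideal_colon /=.
  have -> : z * u l = x - a by rewrite xE; ring.
  apply: is_idealB (is_ideal_U _) Sx _.
  exact: (ideal_mul_subl (is_ideal_U _) ha).
rewrite xE; apply: is_idealD ha _; first exact: is_ideal_mul.
by apply: mul_U_theta T2 _; apply: IHk.
Qed.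

(** The part y of u_l x in U^(k+2) also lies in the ideal of [l |: Sigma]. By [U_cap_exp] it is b +
    u_l z with b in U_Sigma and z in U^(k+1), and moving u_l z to the left leaves u_l (x - z) in
    U_Sigma. *)
Lemma colon_U_exp k Sigma l x : poset_ideal Sigma -> just_above Sigma l ->
  ideal_add (U Sigma *i UL ^^ k) (UL ^^ k.+2) (u l * x) ->
  (UL ^^ k) x ->
  exists z, [/\ (UL ^^ k.+1) z, (UL ^^ k) (x - z) & U Sigma (u l * (x - z))].
Proof.
move=> hS hl [a [y [Sa ky xE]]] kx.
have US_ := is_ideal_U Sigma; have UlS_ := is_ideal_U (l |: Sigma)%SET.
have aS : U Sigma a := ideal_mul_subl US_ Sa.
have yS : U (l |: Sigma)%SET y.
  have -> : y = u l * x - a by rewrite xE; ring.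
  apply: (is_idealB UlS_); last exact: (U_subset (finset.subsetUr _ _) aS).
  by apply: (is_idealMr UlS_); apply: U_mem; rewrite !inE eqxx.
have := U_cap_exp (just_above_poset_ideal hS hl) yS ky.
move=> /U_mul_setU1[|b [z [Sb kz yE]]]; first exact: is_ideal_exp.
exists z; split=> //.
  apply: is_idealB kx _; first exact: is_ideal_exp.
  exact: ideal_expS_sub.
have -> : u l * (x - z) = a + b by rewrite mulrBr xE yE; ring.
by apply: (is_idealD US_) => //; apply: (ideal_mul_subl US_ Sb).
Qed.

(** In x = (x - z) + z, the first term lies in the colon ideal and the second in U. Conversely, u_l
    multiplies the colon ideal into U_Sigma and U into U^2. *)
Lemma colon_U_exp0 Sigma l x : poset_ideal Sigma -> just_above Sigma l ->
  ideal_add (U Sigma *i UL ^^ 0) (UL ^^ 2) (u l * x) <->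
  ideal_add (ideal_colon (U Sigma) (u l)) UL x.
Proof.
move=> hS hl; have US_ := is_ideal_U Sigma; split.
  move=> /(colon_U_exp hS hl) /(_ I)[z [Lz _ Sxz]].
  exists (x - z), z; split; last by ring.
    by rewrite /ideal_colon /= mulrC.
  exact: (ideal_expS_base (is_ideal_U _) Lz).
move=> [y [z [Sy Lz ->]]].
exists (u l * y), (u l * z); split; last by rewrite mulrDr.
  rewrite -[u l * y]mulr1; apply: ideal_mul_mem => //.
  by rewrite mulrC.
have L1z : (UL ^^ 1) z by rewrite ideal_exp1 //; apply: is_ideal_U.
by apply: ideal_mul_mem L1z; apply: U_mem; rewrite inE.
Qed.

(** Here x - z lies in U as well as in the colon ideal, so condition (1) puts it in U_Theta, and
    [U_cap_exp] in U_Theta U^k. The converse is condition (2). The same [Theta] serves all k. *)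
Lemma colon_U_expS Sigma l : poset_ideal Sigma -> just_above Sigma l ->
  exists2 Theta, poset_ideal Theta & forall k x, (UL ^^ k.+1) x ->
    ideal_add (U Sigma *i UL ^^ k.+1) (UL ^^ k.+3) (u l * x) <->
    ideal_add (U Theta *i UL ^^ k) (UL ^^ k.+2) x.
Proof.
move=> hS hl; have lS : inside_or_just_above Sigma l by apply/orP; right.
have [Theta [hT T1 T2]] := u_quadratic hS lS.
exists Theta => // k x kx; split.
  move=> /(colon_U_exp hS hl) /(_ kx)[z [kz kxz Sxz]].
  exists (x - z), z; split=> //; last by ring.
  apply: U_cap_exp => //; apply: T1; split.
    by rewrite /ideal_colon /= mulrC.
  exact: (ideal_expS_base (is_ideal_U _) kxz).
move=> [y [z [Ty kz ->]]].
exists (u l * y), (u l * z); split; last by rewrite mulrDr.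
  exact: (mul_U_theta T2 Ty).
by apply: ideal_mul_mem => //; apply: U_mem; rewrite inE.
Qed.

End QuadraticSequenceTheory.

(** * Homogeneous components *)

Section GradedIdeals.
Variables (K : fieldType) (n : nat).
Local Notation R := {mpoly K[n]}.
Implicit Types (p q a : R) (z e : int) (I J : set R).

(** Degrees are integers so that they can be shifted freely; components of negative degree
    vanish. *)
Definition hcomp z p : R := if z is Posz d then pihomog mdeg d p else 0.

Definition is_hom e p : Prop := forall m, m \in msupp p -> (mdeg m)%:Z = e.

Definition graded I : Prop := forall z p, I p -> I (hcomp z p).

Lemma mcoeff_hcomp z p m :
  (hcomp z p)@_m = if (mdeg m)%:Z == z then p@_m else 0.
Proof.
case: z => [d|d] /=; last by rewrite mcoeff0.
rewrite pihomogE raddf_sum /= eqz_nat.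
under eq_bigr do rewrite mcoeffZ mcoeffX.
rewrite -big_filter; have [md|md] := eqVneq.
  have [mp|mp] := boolP (m \in msupp p).
    rewrite (bigD1_seq m) ?filter_uniq ?msupp_uniq ?mem_filter ?md ?eqxx //=.
    by rewrite mulr1 big1 ?addr0 // => m' /negPf->; rewrite mulr0.
  rewrite big_seq big1 => [|m'].
    by apply/esym/eqP; rewrite mcoeff_eq0.
  rewrite mem_filter => /andP[_ m'p]; have [m'E|_] := eqVneq.
    by rewrite -m'E m'p in mp.
  by rewrite mulr0.
rewrite big_seq big1 // => m'; rewrite mem_filter => /andP[/eqP m'd _].
by have [m'E|_] := eqVneq; [rewrite -m'E m'd eqxx in md|rewrite mulr0].
Qed.

Lemma hcomp_is_additive z : additive (hcomp z).
Proof.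
move=> p q; apply/mpolyP => m; rewrite mcoeffB !mcoeff_hcomp mcoeffB.
by case: ifP => // _; rewrite subr0.
Qed.

HB.instance Definition _ z :=
  GRing.isAdditive.Build R R (hcomp z) (hcomp_is_additive z).

Lemma hcomp_is_hom z p : is_hom z (hcomp z p).
Proof.
by move=> m; rewrite mcoeff_msupp mcoeff_hcomp; case: (_ =P z); rewrite ?eqxx.
Qed.

Lemma is_hom_mcoeff e p m : is_hom e p -> (mdeg m)%:Z != e -> p@_m = 0.
Proof.
move=> hp; apply: contraNeq; rewrite -mcoeff_msupp => /hp ->; exact: eqxx.
Qed.

Lemma hcomp_id e p : is_hom e p -> hcomp e p = p.
Proof.
move=> hp; apply/mpolyP => m; rewrite mcoeff_hcomp.
by have [//|me] := eqVneq; rewrite (is_hom_mcoeff hp).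
Qed.

Lemma hcompMr z e p q : is_hom e q -> hcomp z (p * q) = hcomp (z - e) p * q.
Proof.
move=> hq; apply/mpolyP => m; rewrite mcoeff_hcomp !mcoeffM.
have [mz|mz] := eqVneq.
  apply: eq_bigr => k /eqP mE; rewrite mcoeff_hcomp.
  have {mE}mE : (mdeg m)%:Z = (mdeg k.1)%:Z + (mdeg k.2)%:Z.
    by rewrite -PoszD -mdegD -mE.
  have [//|kz] := eqVneq; rewrite (is_hom_mcoeff hq) ?mulr0 //.
  by apply: contraNneq kz => ke; rewrite -mz mE ke addrK.
rewrite big1 // => k /eqP mE; rewrite mcoeff_hcomp.
have {mE}mE : (mdeg m)%:Z = (mdeg k.1)%:Z + (mdeg k.2)%:Z.
  by rewrite -PoszD -mdegD -mE.
have [kz|kz] := eqVneq; last by rewrite mul0r.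
rewrite (is_hom_mcoeff hq) ?mulr0 //.
by apply: contraNneq mz => ke; rewrite mE kz ke subrK.
Qed.

Lemma sum_hcomp p : p = \sum_(d < msize p) hcomp (Posz d) p.
Proof. exact: pihomog_partitionE. Qed.

Lemma hcompM z a p :
  hcomp z (a * p) = \sum_(d < msize a) hcomp d a * hcomp (z - (d : nat)%:Z) p.
Proof.
rewrite {1}[a]sum_hcomp mulr_suml raddf_sum /=; apply: eq_bigr => d _.
rewrite mulrC (hcompMr _ _ (@hcomp_is_hom d a)); exact: mulrC.
Qed.

Lemma homog_is_hom p : p \is homog mdeg -> is_hom (poly_degree p)%:Z p.
Proof.
rewrite homog_msize => /dhomogP hp m /hp; rewrite /poly_degree.
by move=> <-.
Qed.

(** By [hcompM], the polynomials all of whose components lie in a given ideal form an ideal, so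
    looking at generators is enough. *)
Lemma graded_gen (S : set R) : (forall z p, S p -> ideal_gen S (hcomp z p)) ->
  graded (ideal_gen S).
Proof.
move=> hS z p Sp; have hI : is_ideal (ideal_gen S) := is_ideal_gen S.
suff: ideal_gen S `<=` [set p | forall z, ideal_gen S (hcomp z p)].
  by move=> /(_ p Sp); apply.
apply: ideal_gen_sub => [|{}p {}Sp {}z]; last exact: hS.
split=> [{}z|p1 p2 h1 h2 {}z|a p1 h1 {}z].
- by rewrite raddf0; exact: (is_ideal0 hI).
- by rewrite raddfD; exact: (is_idealD hI (h1 z) (h2 z)).
- rewrite hcompM; apply: (is_ideal_sum _ hI) => d _.
  by apply: (is_idealM hI); apply: h1.
Qed.

Lemma graded_mul I J : graded I -> graded J -> graded (ideal_mul I J).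
Proof.
move=> gI gJ; apply: graded_gen => z _ [x [y [Ix Jy ->]]].
rewrite hcompM; apply: (is_ideal_sum _ (is_ideal_gen _)) => d _.
by apply: ideal_mul_mem; [exact: gI|exact: gJ].
Qed.

Lemma graded_exp I k : graded I -> graded (ideal_exp I k).
Proof. by move=> gI; elim: k => [//|k IHk]; exact: graded_mul. Qed.

Lemma graded_add I J : graded I -> graded J -> graded (ideal_add I J).
Proof.
move=> gI gJ z _ [x [y [Ix Jy ->]]].
by exists (hcomp z x), (hcomp z y); rewrite raddfD; split=> //;
  [exact: gI|exact: gJ].
Qed.

Lemma graded_colon I e x : is_hom e x -> graded I -> graded (ideal_colon I x).
Proof.
move=> hx gI z p; rewrite /ideal_colon /= => Ipx.
by have := gI (z + e) _ Ipx; rewrite (hcompMr _ _ hx) addrK.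
Qed.

Lemma graded_U (disp : Order.disp_t) (L : finPOrderType disp) (u : L -> R)
    (Sigma : {set L}) :
  (forall l, u l \is homog mdeg) -> graded (U_ u Sigma).
Proof.
move=> hu; apply: graded_gen => z _ [l lS ->].
have hI : is_ideal (U_ u Sigma) := is_ideal_U u Sigma.
have hl := homog_is_hom (hu l).
(* Every component of [u l] becomes a component of 1 times [u l]. *)
rewrite -[u l]mul1r (hcompMr _ _ hl).
by apply: (is_idealM hI); apply: U_mem.
Qed.

End GradedIdeals.

(** * Graded submodules of free modules *)

Section GradedModules.
Variables (K : fieldType) (n : nat).
Local Notation R := {mpoly K[n]}.

Definition submod m (B : set 'rV[R]_m) : Prop :=
  [/\ B 0, forall v w, B v -> B w -> B (v + w)
    & forall (a : R) v, B v -> B (a *: v)].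

(** The component of degree z in the graded free module whose l-th generator has degree [g l]. *)
Definition vcomp m (g : 'I_m -> int) (z : int) (v : 'rV[R]_m) : 'rV[R]_m :=
  \row_l hcomp (z - g l) (v 0 l).

Definition vgraded m (g : 'I_m -> int) (B : set 'rV[R]_m) : Prop :=
  forall z v, B v -> B (vcomp g z v).

Definition mhom a b (ga : 'I_a -> int) (gb : 'I_b -> int) (D : 'M[R]_(a, b)) :
  Prop := forall k l m, m \in msupp (D k l) -> gb l + (mdeg m)%:Z = ga k.

Lemma mhomP a b ga gb (D : 'M[R]_(a, b)) :
  mhom ga gb D <-> forall k l, is_hom (ga k - gb l) (D k l).
Proof.
split=> [h k l m mD|h k l m mD]; first by rewrite -(h k l m mD) addrC addKr.
by rewrite (h k l m mD) addrC subrK.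
Qed.

Lemma submodB m (B : set 'rV[R]_m) v w :
  submod B -> B v -> B w -> B (v - w).
Proof.
by case=> _ hD hZ Bv Bw; apply: hD => //; rewrite -scaleN1r; apply: hZ.
Qed.

Lemma submod_mulmx a b (B : set 'rV[R]_b) (v : 'rV_a) (D : 'M[R]_(a, b)) :
  submod B -> (forall k, B (row k D)) -> B (v *m D).
Proof.
case=> B0 BD BZ h; rewrite mulmx_sum_row; elim/big_ind: _ => // i _; exact: BZ.
Qed.

Lemma submod0 m : submod ([set 0] : set 'rV[R]_m).
Proof.
by split=> [//|v w -> ->|a v ->]; rewrite /= ?addr0 ?scaler0.
Qed.

Lemma vgraded0 m g : vgraded g ([set 0] : set 'rV[R]_m).
Proof.
by move=> z v ->; apply/rowP => l; rewrite !mxE raddf0.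
Qed.

Lemma submod_setT m : submod (setT : set 'rV[R]_m).
Proof. by []. Qed.

Lemma vcompB m g z (v w : 'rV[R]_m) :
  vcomp g z (v - w) = vcomp g z v - vcomp g z w.
Proof. by apply/rowP => l; rewrite !mxE raddfB. Qed.

Lemma vcomp_mulmx a b ga gb z (v : 'rV_a) (D : 'M[R]_(a, b)) :
  mhom ga gb D -> vcomp gb z (v *m D) = vcomp ga z v *m D.
Proof.
move=> /mhomP hD; apply/rowP => l; rewrite !mxE raddf_sum /=.
apply: eq_bigr => k _; rewrite mxE (hcompMr _ _ (hD k l)).
by congr (hcomp _ _ * _); ring.
Qed.

Lemma vcomp_row a b ga gb (D : 'M[R]_(a, b)) k :
  mhom ga gb D -> vcomp gb (ga k) (row k D) = row k D.
Proof. by move=> /mhomP hD; apply/rowP => l; rewrite !mxE hcomp_id. Qed.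

(** Of each coefficient of a lift, only the component of the expected degree is kept. The relation
    modulo B survives, because B is graded and both maps are homogeneous. *)
Lemma homogeneous_lift a b c ga gb gc (B : set 'rV[R]_c)
    (M : 'M[R]_(a, c)) (D : 'M[R]_(b, c)) :
  submod B -> vgraded gc B -> mhom ga gc M -> mhom gb gc D ->
  (forall k, exists x, B (row k M - x *m D)) ->
  exists2 X : 'M[R]_(a, b), mhom ga gb X & forall v, B (v *m (M - X *m D)).
Proof.
move=> sB gB hM hD /choice[x hx].
exists (\matrix_(k, l) hcomp (ga k - gb l) (x k 0 l)).
  by apply/mhomP => k l; rewrite mxE; apply: hcomp_is_hom.
move=> v; apply: submod_mulmx => // k.
have := gB (ga k) _ (hx k).
rewrite vcompB (vcomp_row _ hM) (vcomp_mulmx _ _ hD) linearB /= row_mul.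
by congr (B (_ - _ *m _)); apply/rowP => l; rewrite !mxE.
Qed.

End GradedModules.

(** * Resolutions of subquotients of the polynomial ring *)

(** [G] is the invariant that makes the next choice possible, and [Q] links consecutive choices. The
    types vary with i, as those of the components of a chain map do. *)
Lemma dependent_choice (X : nat -> Type) (G : forall i, X i -> Prop)
    (Q : forall i, X i -> X i.+1 -> Prop) (x0 : X 0) :
  G 0 x0 -> (forall i x, G i x -> exists y, G i.+1 y /\ Q i x y) ->
  exists f : forall i, X i,
    [/\ f 0 = x0, forall i, G i (f i) & forall i, Q i (f i) (f i.+1)].
Proof.
move=> G0 step.
pose next i (x : {x : X i | G i x}) : {y : X i.+1 | G i.+1 y} :=
  let: exist y Gy := cid (step i (sval x) (svalP x)) in exist _ y (proj1 Gy).
have nextQ i x : Q i (sval x) (sval (@next i x)).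
  by rewrite /next; case: cid => y [].
pose s := nat_rect (fun i => {x : X i | G i x}) (exist _ x0 G0) next.
exists (fun i => sval (s i)); by split=> // i; exact: svalP.
Qed.

Section Resolutions.
Variables (K : fieldType) (n : nat).
Local Notation R := {mpoly K[n]}.
Local Notation seqF := (graded_free_sequence K n).
Implicit Types (A B C I : set R) (F G : seqF).

(** The subquotient A/B is handled through representatives in R: the augmentation has values in A,
    and exactness at F_0 is modulo B. *)
Definition resolves A B F : Prop :=
  [/\ forall k, A (aug F k 0),
      forall p, A p -> exists v : 'rV_(rk F 0), B (p - (v *m aug F) 0 0),
      forall v : 'rV_(rk F 0),
        B ((v *m aug F) 0 0) <-> exists w, v = w *m dif F 0
    & forall i (v : 'rV_(rk F i.+1)),
        v *m dif F i = 0 <-> exists w, v = w *m dif F i.+1].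

(** The source of a comparison map only has to be a complex; the target has to be exact. *)
Definition is_cplx B F : Prop :=
  (forall v : 'rV_(rk F 1), B ((v *m dif F 0 *m aug F) 0 0)) /\
  (forall i, dif F i.+1 *m dif F i = 0).

(* The subquotient A/B of R has regularity at most r. *)
Definition reg_le (r : int) A B : Prop :=
  exists2 F, resolves A B F & forall i k, gdeg (g := F) (i := i) k <= r + i%:Z.

Lemma mhom_mul a b c ga gb gc (D : 'M[R]_(a, b)) (E : 'M[R]_(b, c)) :
  mhom ga gb D -> mhom gb gc E -> mhom ga gc (D *m E).
Proof.
move=> hD hE; apply/mhomP => k l.
have -> : (D *m E) k l = hcomp (ga k - gc l) ((D *m E) k l).
  have := vcomp_mulmx (ga k) (row k D) hE.
  rewrite (vcomp_row _ hD) -row_mul => /rowP/(_ l).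
  by rewrite mxE ![row k (D *m E) 0 l]mxE => ->.
exact: hcomp_is_hom.
Qed.

Lemma mhomN a b ga gb (D : 'M[R]_(a, b)) : mhom ga gb D -> mhom ga gb (- D).
Proof.
move=> hD k l m; rewrite mxE (perm_mem (msuppN _)); exact: hD.
Qed.

Lemma aug_mhom F : mhom (gdeg (g := F) (i := 0)) (fun _ => 0) (aug F).
Proof. by move=> k l m; rewrite ord1 => /aug_homog ->; rewrite add0r. Qed.

Lemma dif_mhom F i :
  mhom (gdeg (g := F) (i := i.+1)) (gdeg (g := F) (i := i)) (dif F i).
Proof. by move=> k l m; apply: dif_homog. Qed.

Lemma resolves_is_cplx A B F : resolves A B F -> is_cplx B F.
Proof.
case=> _ _ h0 hS; split=> [v|i]; first by apply/h0; exists v.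
apply/row_matrixP => k; rewrite row0 row_mul; apply/hS.
by exists (delta_mx 0 k); rewrite -rowE.
Qed.

Lemma rows_factor a b c (M : 'M[R]_(a, c)) (D : 'M[R]_(b, c)) :
  (forall v : 'rV_a, exists w, v *m M = w *m D) -> exists X, M = X *m D.
Proof.
move=> h; have /choice[x hx] : forall k, exists w, row k M = w *m D.
  by move=> k; have [w] := h (delta_mx 0 k); rewrite -rowE => ->; exists w.
exists (\matrix_k x k); apply/row_matrixP => k.
by rewrite row_mul rowK.
Qed.

(** Sets of polynomials are viewed in the free module of rank 1, so that the results on row vectors
    apply to the augmentation. *)
Definition scalar_set B : set 'rV[R]_1 := [set v | B (v 0 0)].

Lemma submod_scalar_set B : is_ideal B -> submod (scalar_set B).
Proof.
move=> hB; split=> [|v w|a v]; rewrite /scalar_set /= !mxE.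
- exact: (is_ideal0 hB).
- exact: (is_idealD hB).
- exact: (is_idealM hB).
Qed.

Lemma vgraded_scalar_set B : graded B -> vgraded (fun _ => 0) (scalar_set B).
Proof. by move=> gB z v Bv; rewrite /scalar_set /= mxE subr0; apply: gB. Qed.

Lemma mulmx_aug_mem A F (v : 'rV_(rk F 0)) :
  is_ideal A -> (forall k, A (aug F k 0)) -> A ((v *m aug F) 0 0).
Proof.
move=> hA hF; rewrite mxE; apply: (is_ideal_sum _ hA) => k _.
exact: (is_idealM hA).
Qed.

(** The comparison theorem: the freeness of F gives each lift, and the exactness of G makes the next
    one possible. *)
Lemma comparison A B F G : is_ideal B -> graded B ->
  (forall k, A (aug F k 0)) -> is_cplx B F -> resolves A B G ->
  exists f : forall i, 'M[R]_(rk F i, rk G i),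
    [/\ forall i, mhom (gdeg (g := F) (i := i)) (gdeg (g := G) (i := i)) (f i),
        forall v : 'rV_(rk F 0), B ((v *m (aug F - f 0 *m aug G)) 0 0)
      & forall i, f i.+1 *m dif G i = dif F i *m f i].
Proof.
move=> hB gB AF [cF0 cFS] [_ G0 G1 GS].
have [|f0 f0h f0E] := homogeneous_lift (submod_scalar_set hB)
    (vgraded_scalar_set gB) (@aug_mhom F) (@aug_mhom G).
  move=> k; have [v Bv] := G0 _ (AF k); exists v.
  by move: Bv; rewrite /scalar_set /= !mxE.
(* [P] says that f is homogeneous and that the next square can be filled in, [Q] that this square
   commutes. *)
pose P i (f : 'M[R]_(rk F i, rk G i)) :=
  mhom (gdeg (g := F) (i := i)) (gdeg (g := G) (i := i)) f /\
  forall v : 'rV_(rk F i.+1), exists w, v *m (dif F i *m f) = w *m dif G i.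
pose Q i (f : 'M[R]_(rk F i, rk G i)) (f' : 'M[R]_(rk F i.+1, rk G i.+1)) :=
  f' *m dif G i = dif F i *m f.
have P0 : P 0%N f0.
  split=> // v; apply/G1.
  have := is_idealB hB (cF0 v) (f0E (v *m dif F 0)).
  by rewrite mulmxBr !mulmxA !mxE opprB addrC subrK.
have step i f : P i f -> exists f', P i.+1 f' /\ Q i f f'.
  move=> [fh fE].
  have [|X Xh XE] := homogeneous_lift (@submod0 _ _ _) (@vgraded0 _ _ _ _)
      (mhom_mul (@dif_mhom F i) fh) (@dif_mhom G i).
    move=> k; have [w hw] := fE (delta_mx 0 k); exists w.
    by rewrite rowE hw subrr.
  have XE' : X *m dif G i = dif F i *m f.
    apply/row_matrixP => k; apply/esym/eqP; rewrite -subr_eq0 -linearB /=.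
    by rewrite rowE XE.
  exists X; split=> //; split=> // v; apply/GS.
  by rewrite -!mulmxA XE' (mulmxA (dif F i.+1)) cFS mul0mx mulmx0.
have [f [f0' Pf Qf]] := dependent_choice P0 step.
by exists f; split=> [i|v|i]; [case: (Pf i)|rewrite f0'; exact: f0E|exact: Qf].
Qed.

Lemma reg_le_mono r r' A B : r <= r' -> reg_le r A B -> reg_le r' A B.
Proof.
move=> rr' [F hF hr]; exists F => // i k; apply: le_trans (hr i k) _.
by rewrite lerD2r.
Qed.

Definition zero_sequence : seqF.
Proof.
exists (fun _ => 0%N) (fun _ _ => 0) 0 (fun _ => 0); first by case.
by move=> i [].
Defined.

Lemma reg_le_refl r A : is_ideal A -> reg_le r A A.
Proof.
move=> hA; exists zero_sequence => [|i []] //.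
have z v : (v : 'rV[R]_0) = 0 by apply/rowP => -[].
split=> [[]|p Ap|v|i v] //=.
- by exists 0; rewrite mul0mx mxE subr0.
- rewrite (z v) mul0mx mxE; split=> _; last exact: (is_ideal0 hA).
  by exists 0; rewrite mul0mx.
- by rewrite (z v); split=> _; [exists 0; rewrite mul0mx|rewrite mul0mx].
Qed.

Definition scale_sequence (e : nat) (x : R) (hx : is_hom e%:Z x) F : seqF.
Proof.
exists (rk F) (fun i k => gdeg (g := F) (i := i) k + e%:Z) (x *: aug F) (dif F).
- move=> k m; rewrite mxE mulrC => mx.
  suff : is_hom (gdeg k + e%:Z) (aug F k 0 * x) by exact.
  have hk : is_hom (gdeg k) (aug F k 0) by move=> m'; apply: aug_homog.
  rewrite -[aug F k 0 * x](_ : hcomp (gdeg k + e%:Z) (aug F k 0 * x) = _).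
    exact: hcomp_is_hom.
  by rewrite (hcompMr _ _ hx) addrK hcomp_id.
- by move=> i k l m /dif_homog <-; rewrite addrAC.
Defined.

(** The hypotheses make multiplication by x an isomorphism from A'/B', shifted by e, onto A/B.
    Composing the augmentation with it turns a resolution of the former into one of the latter. *)
Lemma reg_le_scale r e (x : R) A A' B B' : is_hom e%:Z x ->
  is_ideal B ->
  (forall a, A' a -> A (x * a)) ->
  (forall p, A p -> exists2 a, A' a & B (p - x * a)) ->
  (forall a, A' a -> B (x * a) <-> B' a) -> is_ideal A' ->
  reg_le r A' B' -> reg_le (r + e%:Z) A B.
Proof.
move=> hx hB xA Ax xB hA' [F [F0 F1 F2 FS] hr].
exists (scale_sequence hx F); last first.
  by move=> i k /=; rewrite addrAC lerD2r.
have xv (v : 'rV_(rk F 0)) : (v *m (x *: aug F)) 0 0 = x * (v *m aug F) 0 0.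
  by rewrite -scalemxAr mxE.
split=> [k|p Ap|v|i v] /=.
- by rewrite mxE; apply: xA.
- have [a A'a Ba] := Ax p Ap; have [v hv] := F1 a A'a.
  exists v; rewrite xv; have -> : p - x * (v *m aug F) 0 0 =
    (p - x * a) + x * (a - (v *m aug F) 0 0) by ring.
  apply: (is_idealD hB) => //; apply/xB => //.
  apply: (is_idealB hA') => //; exact: mulmx_aug_mem.
- rewrite xv; apply: iff_trans (F2 v); apply: xB; exact: mulmx_aug_mem.
- exact: FS.
Qed.

End Resolutions.

(** * Extensions and minimality *)

Section Extensions.
Variables (K : fieldType) (n : nat).
Local Notation R := {mpoly K[n]}.
Local Notation seqF := (graded_free_sequence K n).
Implicit Types (A B C I : set R) (F G : seqF).

Definition gcat a b (ga : 'I_a -> int) (gb : 'I_b -> int) (k : 'I_(a + b)) :=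
  match split k with inl i => ga i | inr j => gb j end.

Lemma gcat_lshift a b ga gb k : @gcat a b ga gb (lshift b k) = ga k.
Proof. by rewrite /gcat (unsplitK (inl k)). Qed.

Lemma gcat_rshift a b ga gb k : @gcat a b ga gb (rshift a k) = gb k.
Proof. by rewrite /gcat (unsplitK (inr k)). Qed.

Lemma mhom_block a b c d ga gb gc gd (D : 'M[R]_(a, c)) (T : 'M[R]_(a, d))
    (E : 'M[R]_(b, d)) :
  mhom ga gc D -> mhom ga gd T -> mhom gb gd E ->
  mhom (gcat ga gb) (gcat gc gd) (block_mx D T 0 E).
Proof.
move=> hD hT hE k l m.
have [k' ->|k' ->] := split_ordP k; have [l' ->|l' ->] := split_ordP l;
  rewrite ?block_mxEul ?block_mxEur ?block_mxEdl ?block_mxEdr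
          ?gcat_lshift ?gcat_rshift.
- exact: hD.
- exact: hT.
- by rewrite mxE msupp0.
- exact: hE.
Qed.

(** F_0 is removed, and the composite F_1 -> F_0 -> R becomes, up to sign, the augmentation; its
    values lie in B if F resolves A/B. With these signs, a chain map f to G satisfies d f + f d = 0
    for the differentials d of F and G. *)
Definition shift_sequence F : seqF.
Proof.
exists (fun i => rk F i.+1) (fun i k => gdeg (g := F) (i := i.+1) k)
  (- (dif F 0 *m aug F)) (fun i => - dif F i.+1).
- move=> k m mk.
  by rewrite -(mhomN (mhom_mul (@dif_mhom _ _ F 0) (@aug_mhom _ _ F)) mk) add0r.
- by move=> i; apply: mhomN; apply: dif_mhom.
Defined.

(** For a chain map f from [shift_sequence F] to G, this is its mapping cone in positive degrees,
    with F_0 put back in degree 0. *)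
Definition ext_sequence F G (f : forall i, 'M[R]_(rk F i.+1, rk G i))
    (fh : forall i,
       mhom (gdeg (g := F) (i := i.+1)) (gdeg (g := G) (i := i)) (f i)) : seqF.
Proof.
exists (fun i => rk F i + rk G i)%N
  (fun i => gcat (gdeg (g := F) (i := i)) (gdeg (g := G) (i := i)))
  (col_mx (aug F) (aug G)) (fun i => block_mx (dif F i) (f i) 0 (dif G i)).
- move=> k m; have [k' ->|k' ->] := split_ordP k.
    by rewrite col_mxEu gcat_lshift; apply: aug_homog.
  by rewrite col_mxEd gcat_rshift; apply: aug_homog.
- by move=> i; apply: mhom_block => //; apply: dif_mhom.
Defined.

(* The horseshoe lemma. The off-diagonal blocks of the differentials come from
   comparing the resolution of A/B, shifted by one step, with that of B/C. *)
Lemma reg_le_trans r A B C : is_ideal A -> is_ideal B -> is_ideal C ->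
  graded C -> B `<=` A -> C `<=` B ->
  reg_le r A B -> reg_le r B C -> reg_le r A C.
Proof.
move=> hA hB hC gC BA CB [F hF Fr] [G hG Gr].
have [cF0 cFS] := resolves_is_cplx hF.
have [| |f [fh f0 fS]] := @comparison _ _ B C (shift_sequence F) G hC gC _ _ hG.
- move=> k /=; have := cF0 (delta_mx 0 k).
  rewrite -mulmxA -rowE !mxE; exact: (is_idealN hB).
- split=> [v|i] /=.
    rewrite mulmxN mulmxN mulNmx opprK mulmxA -(mulmxA v) cFS mulmx0 mul0mx mxE.
    exact: (is_ideal0 hC).
  by rewrite mulmxN mulNmx opprK cFS.
move: hF hG => [F0 F1 F2 FS] [G0 G1 G2 GS].
exists (@ext_sequence F G f fh); last first.
  move=> i k /=; have [k' ->|k' ->] := split_ordP k.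
    by rewrite gcat_lshift.
  by rewrite gcat_rshift.
have f0' (v : 'rV_(rk F 1)) : C ((v *m (dif F 0 *m aug F + f 0 *m aug G)) 0 0).
  have -> : dif F 0 *m aug F + f 0 *m aug G =
    - (aug (shift_sequence F) - f 0 *m aug G) by rewrite /= opprD !opprK.
  rewrite mulmxN mxE; exact: (is_idealN hC (f0 v)).
split=> [k|p Ap|v|i v] /=.
- have [k' ->|k' ->] := split_ordP k; first by rewrite col_mxEu.
  by rewrite col_mxEd; apply: BA.
(* F reaches p up to a remainder in B, which G reaches up to C. *)
- have [v Bv] := F1 p Ap; have [w Cw] := G1 _ Bv.
  by exists (row_mx v w); rewrite mul_row_col mxE opprD addrA.
- rewrite -[v]hsubmxK mul_row_col; set a := lsubmx v; set b := rsubmx v.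
  split=> [Cab|[w]].
    (* The image of a lies in B, so a comes from some x in F_1; then b - x f_0 is sent into C, hence
       comes from some y in G_1. The same chase gives exactness in higher degrees. *)
    have Bb : B ((b *m aug G) 0 0) by apply: mulmx_aug_mem.
    have : B ((a *m aug F) 0 0).
      have -> : (a *m aug F) 0 0 =
        (a *m aug F + b *m aug G) 0 0 - (b *m aug G) 0 0.
        by rewrite [X in _ = X - _]mxE addrK.
      by apply: (is_idealB hB) => //; apply: CB.
    move=> /F2[x xE].
    have /G2[y yE] : C (((b - x *m f 0) *m aug G) 0 0).
      have := is_idealB hC Cab (f0' x).
      rewrite mulmxDr !mulmxA -xE mulmxBl !mxE opprD addrACA subrr add0r.
      exact.
    exists (row_mx x y); rewrite mul_row_block mulmx0 addr0 -xE -yE.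
    by rewrite addrC subrK.
  rewrite -[w]hsubmxK mul_row_block mulmx0 addr0.
  set x := lsubmx w; set y := rsubmx w => /eq_row_mx[-> ->].
  have -> : x *m dif F 0 *m aug F + (x *m f 0 + y *m dif G 0) *m aug G =
    x *m (dif F 0 *m aug F + f 0 *m aug G) + y *m dif G 0 *m aug G.
    by rewrite mulmxDl mulmxDr !mulmxA addrA.
  rewrite mxE; apply: (is_idealD hC (f0' x)).
  by apply/G2; exists y.
- have fS' j : dif F j.+1 *m f j + f j.+1 *m dif G j = 0.
    by rewrite fS /= mulNmx subrr.
  rewrite -[v]hsubmxK mul_row_block mulmx0 addr0.
  set a := lsubmx v; set b := rsubmx v; split=> [|[w]].
    rewrite -row_mx0 => /eq_row_mx[/FS[x xE]].
    rewrite xE => abE.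
    have /GS[y yE] : (b - x *m f i.+1) *m dif G i = 0.
      rewrite mulmxBl -mulmxA fS /= mulNmx mulmxN opprK addrC mulmxA.
      exact: abE.
    exists (row_mx x y); rewrite mul_row_block mulmx0 addr0 -yE.
    by rewrite addrC subrK.
  rewrite -[w]hsubmxK mul_row_block mulmx0 addr0.
  set x := lsubmx w; set y := rsubmx w => /eq_row_mx[-> ->].
  rewrite -mulmxA cFS mulmx0 mulmxDl -mulmxA addrA -!mulmxA -mulmxDr fS'.
  have -> : dif G i.+1 *m dif G i = 0.
    apply/row_matrixP => k; rewrite row0 row_mul; apply/GS.
    by exists (delta_mx 0 k); rewrite -rowE.
  by rewrite !mulmx0 addr0 row_mx0.
Qed.

End Extensions.

(** * Degrees of the generators of a minimal resolution *)

Section Minimality.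
Variables (K : fieldType) (n : nat).
Local Notation R := {mpoly K[n]}.
Local Notation seqF := (graded_free_sequence K n).
Implicit Types (A B C I : set R) (F G : seqF).

(** Reduction of a matrix modulo the irrelevant maximal ideal. *)
Local Notation cst := (map_mx (mcoeff (0%MM : 'X_{1..n}))).

Lemma minimal_resolves I F :
  minimal_free_resolution I F -> resolves setT I F.
Proof. by case=> h0 h1 h2 _; split. Qed.

(* A lifting F -> G -> F of the identity is homotopic to the identity, hence is
   the identity modulo the irrelevant ideal. *)
Lemma minimal_gdeg I F G : is_ideal I -> graded I ->
  minimal_free_resolution I F -> resolves setT I G ->
  forall i (k : 'I_(rk F i)), exists l : 'I_(rk G i), gdeg k = gdeg l.
Proof.
move=> hI gI mF rG; have rF := minimal_resolves mF.
have cF := resolves_is_cplx rF; have cG := resolves_is_cplx rG.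
have [f [fh f0 fS]] := comparison hI gI (fun _ => Logic.I) cF rG.
have [g [gh g0 gS]] := comparison hI gI (fun _ => Logic.I) cG rF.
have [_ _ _ min] := mF; have [_ _ F2 FS] := rF.
pose c i : 'M[R]_(rk F i) := f i *m g i - 1%:M.
have cS i : c i.+1 *m dif F i = dif F i *m c i.
  by rewrite mulmxBl mulmxBr mul1mx mulmx1 -mulmxA gS !mulmxA fS.
have dif0 i : cst (dif F i) = 0 by apply/matrixP => k l; rewrite !mxE min.
have cst_mul i m (h : 'M[R]_(m, _)) : cst (h *m dif F i) = 0.
  by rewrite map_mxM dif0 mulmx0.
(* Here h is the homotopy in degree i. The difference [c i - h *m dif F i] is 0 for i = 0 and
   otherwise the differential followed by the previous h; the induction records only that the
   differential kills it and that its constant terms vanish. *)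
have homotopy i : exists h : 'M_(rk F i, rk F i.+1),
    dif F i *m (c i - h *m dif F i) = 0 /\ cst (c i - h *m dif F i) = 0.
  elim: i => [|i [h [h1 h2]]].
    have [h hE] : exists h, c 0%N = h *m dif F 0.
      apply: rows_factor => v; apply/F2.
      have := is_idealN hI (is_idealD hI (f0 v) (g0 (v *m f 0%N))).
      rewrite mulmxBr (mulmxBr (v *m f 0%N)) !mulmxA /c mulmxBr mulmx1 mulmxBl.
      by rewrite !mxE !mulmxA addrA subrK opprB.
    by exists h; rewrite -hE subrr mulmx0 map_mx0.
  have [h' h'E] : exists h', c i.+1 - dif F i *m h = h' *m dif F i.+1.
    apply: rows_factor => v; apply/FS.
    by rewrite -mulmxA mulmxBl cS -mulmxA -mulmxBr h1 mulmx0.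
  exists h'; have -> : c i.+1 - h' *m dif F i.+1 = dif F i *m h.
    by rewrite -h'E opprB addrC subrK.
  by rewrite mulmxA (proj2 cF) mul0mx map_mxM dif0 mul0mx.
move=> i k; have [h [_ h2]] := homotopy i.
have : cst (c i) = 0.
  by rewrite -[c i](subrK (h *m dif F i)) map_mxD h2 cst_mul addr0.
rewrite map_mxB map_mx1 => /eqP; rewrite subr_eq0 => /eqP/matrixP/(_ k k).
rewrite map_mxM !mxE eqxx => sum1.
(* Modulo the irrelevant ideal, the k-th diagonal entry of f g is 1, so row k of f has an entry with
   a nonzero constant term, and homogeneity equates the two degrees. *)
have [l fl] : exists l, (f i k l)@_0%MM != 0.
  apply/existsP; apply: contraT => /existsPn h0; move: sum1; rewrite big1.
    by move=> /esym/eqP; rewrite oner_eq0.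
  by move=> l _; rewrite !mxE [X in X * _](eqP (negbNE (h0 l))) mul0r.
exists l; rewrite -mcoeff_msupp in fl.
by rewrite -(fh i k l _ fl) mdeg0 addr0.
Qed.

End Minimality.

(** * Noetherianity *)

(** Beyond any N, g takes its least value at some index [h N]. Restarting just after each such index
    gives nondecreasing values. *)
Lemma nondecreasing_subsequence (g : nat -> nat) :
  exists2 phi : nat -> nat, {homo phi : i j / (i < j)%N} &
    {homo (g \o phi) : i j / (i <= j)%N}.
Proof.
have /choice[h hP] : forall N, exists k,
    (N <= k)%N /\ forall l, (N <= l)%N -> (g k <= g l)%N.
  move=> N; have ex : exists v, `[< exists2 k, (N <= k)%N & g k = v >].
    by exists (g N); apply/asboolP; exists N.
  case: (ex_minnP ex) => v /asboolP[k Nk gk] vmin; exists k; split=> // l Nl.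
  by rewrite gk; apply: vmin; apply/asboolP; exists l.
pose b := nat_rect (fun _ => nat) 0 (fun _ b => (h b).+1).
have bh i : (b i <= h (b i))%N by case: (hP (b i)).
exists (h \o b).
  by apply: homo_ltn; [exact: ltn_trans|move=> i; apply: (bh i.+1)].
apply: homo_leq; [exact: leqnn|exact: leq_trans|move=> i /=].
have [_] := hP (b i); apply; apply: leq_trans (bh i) _.
by apply: leq_trans (bh i.+1); apply: leqnSn.
Qed.

(** Nondecreasing subsequences are extracted for one coordinate after the other; the first two
    indices of the last one will do. *)
Lemma dickson (T : finType) (f : nat -> T -> nat) :
  exists i j, (i < j)%N /\ forall t, (f i t <= f j t)%N.
Proof.
suff [phi phiS phiP] : exists2 phi : nat -> nat,
    {homo phi : i j / (i < j)%N} &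
    forall t, t \in enum T -> {homo (fun i => f (phi i) t) : i j / (i <= j)%N}.
  exists (phi 0%N), (phi 1%N); split; first exact: phiS.
  by move=> t; apply: phiP; rewrite ?mem_enum.
elim: (enum T) => [|t r [phi phiS phiP]]; first by exists id.
have [psi psiS psiP] := nondecreasing_subsequence (fun i => f (phi i) t).
exists (phi \o psi) => [i j ij|t']; first by apply/phiS/psiS.
rewrite inE => /orP[/eqP->|t'r i j ij]; first exact: psiP.
apply: phiP => //.
exact: (homo_leq leqnn leq_trans (fun k => ltnW (psiS k k.+1 (leqnn _)))).
Qed.

Section Noetherian.
Variables (K : fieldType) (n : nat).
Local Notation R := {mpoly K[n]}.

Lemma exists_min_monomial (P : 'X_{1..n} -> Prop) :
  (exists m, P m) -> exists2 m, P m & forall m', P m' -> (m <= m')%O.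
Proof.
move=> [m Pm]; apply: contrapT => h.
elim/(well_founded_ind (@ltom_wf n)): m Pm => m IH Pm.
apply: h; exists m => // m' Pm'; rewrite leNgt; apply/negP => lm.
exact: IH lm Pm'.
Qed.

(** First the number d of leading zeros is made as large as possible, which forces entry d to be
    nonzero; then the leading monomial of this entry is made as small as possible. *)
Lemma exists_min_vector m (S : set 'rV[R]_m) :
  ~ S 0 -> (exists v, S v) -> exists (d : 'I_m) v,
    [/\ S v, forall l : 'I_m, (l < d)%N -> v 0 l = 0, v 0 d != 0 &
      forall w, S w -> (forall l : 'I_m, (l < d)%N -> w 0 l = 0) ->
        w 0 d != 0 /\ (mlead (v 0 d) <= mlead (w 0 d))%O].
Proof.
move=> S0 [v0 Sv0].
pose Z d v := S v /\ forall l : 'I_m, (l < d)%N -> v 0 l = 0.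
have exd : exists d, `[< exists v, Z d v >].
  by exists 0%N; apply/asboolP; exists v0.
have Zm d v : Z d v -> (d < m)%N.
  move=> [Sv vd]; rewrite ltnNge; apply/negP => md; apply: S0.
  by suff <- : v = 0 by []; apply/rowP => l; rewrite mxE vd // (leq_trans _ md).
have bd d : `[< exists v, Z d v >] -> (d <= m)%N.
  by move=> /asboolP[v /Zm/ltnW].
case: (ex_maxnP exd bd) => d /asboolP[v1 Zv1] dmax.
pose d' := Ordinal (Zm _ _ Zv1).
have Znz w : Z d w -> w 0 d' != 0.
  move=> [Sw wd]; apply/eqP => w0; have := dmax d.+1; rewrite ltnn => h.
  suff : false by []; apply: h; apply/asboolP; exists w; split=> // l.
  rewrite ltnS leq_eqVlt => /orP[/eqP ld|]; last exact: wd.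
  by rewrite -w0; congr (w 0 _); apply: val_inj.
have [m0 [v [Zv <-]] vmin] := @exists_min_monomial
  (fun m0 => exists v, Z d v /\ mlead (v 0 d') = m0)
  (ex_intro _ _ (ex_intro _ v1 (conj Zv1 erefl))).
exists d', v; split; [by case: Zv|by case: Zv|exact: Znz|].
move=> w Sw wd; have Zw : Z d w by [].
by split; [exact: Znz|apply: vmin; exists w].
Qed.

Definition span m (s : seq 'rV[R]_m) : set 'rV[R]_m :=
  [set v | forall B, submod B -> (forall w, w \in s -> B w) -> B v].

Lemma submod_span m (s : seq 'rV[R]_m) : submod (span s).
Proof.
split=> [B [] //|v w hv hw B sB hB|a v hv B sB hB].
  by have [_ hD _] := sB; apply: hD; [apply: hv|apply: hw].
by have [_ _ hZ] := sB; apply: hZ; apply: hv.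
Qed.

Lemma span_mem m (s : seq 'rV[R]_m) v : v \in s -> span s v.
Proof. by move=> vs B _; apply. Qed.

Lemma mlead_cancel (p q : R) : p != 0 -> q != 0 ->
  (mlead q <= mlead p)%MM ->
  let r := p - (mleadc p / mleadc q) *: 'X_[(mlead p - mlead q)%MM] * q in
  r != 0 -> (mlead r < mlead p)%O.
Proof.
move=> p0 q0 qp; set c := mleadc p / mleadc q.
set t := c *: 'X_[(mlead p - mlead q)%MM] * q => r r0.
have c0 : c != 0 by rewrite mulf_neq0 ?invr_eq0 ?mleadc_eq0.
have X0 : c *: 'X_[(mlead p - mlead q)%MM] != 0 :> R.
  by rewrite -msupp_eq0 msuppMCX.
have tl : mlead t = mlead p.
  by rewrite mleadM // mleadZ // mleadXm submK.
rewrite lt_neqAle; apply/andP; split; last first.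
  by apply: le_trans (mleadB_le _ _) _; rewrite tl joinxx.
apply/eqP => rl; move: (r0); rewrite -mleadc_eq0 rl mcoeffB.
have -> : t@_(mlead p) = p@_(mlead p).
  have := mcoeffMX q (mlead p - mlead q)%MM (mlead q).
  rewrite submK // /t -scalerAl mcoeffZ [_ * q]mulrC => ->.
  by rewrite divfK // mleadc_eq0.
by rewrite subrr eqxx.
Qed.

(** Otherwise, vectors of N outside the span of the previous ones, minimal as in
    [exists_min_vector], could be picked forever. Dickson's lemma gives two of them with the same
    first nonzero position, the earlier leading monomial dividing the later one. Cancelling the
    leading term of the later vector contradicts its minimality. *)
Lemma noetherian m (N : set 'rV[R]_m) : submod N ->
  exists s : seq 'rV[R]_m, (forall v, v \in s -> N v) /\ N `<=` span s.
Proof.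
move=> sN; apply: contrapT => notfg.
(* The guard on s lets [choice] range over all lists; those not contained in N receive the dummy
   value [dv0]. *)
pose P (s : seq 'rV[R]_m) (dv : 'I_m * 'rV[R]_m) := let: (d, v) := dv in
  (forall w, w \in s -> N w) ->
  [/\ N v, ~ span s v, forall l : 'I_m, (l < d)%N -> v 0 l = 0, v 0 d != 0 &
    forall w, N w -> ~ span s w -> (forall l : 'I_m, (l < d)%N -> w 0 l = 0) ->
      w 0 d != 0 /\ (mlead (v 0 d) <= mlead (w 0 d))%O].
have exP s : (forall w, w \in s -> N w) -> exists dv, P s dv.
  move=> sNs; have [|| d [v [[Nv sv] vd v0 vmin]]] :=
      @exists_min_vector m [set v | N v /\ ~ span s v].
  - by move=> [_]; apply; case: (submod_span s).
  - apply: contrapT => h; apply: notfg; exists s; split=> // v Nv.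
    by apply: contrapT => sv; apply: h; exists v.
  - exists (d, v) => _; split=> // w Nw sw; exact: vmin.
have [dv0 _] := exP [::] (fun _ h => ltac:(by [])).
have /choice[pick pickP] : forall s, exists dv, P s dv.
  move=> s; have [/exP//|h] := pselect (forall w, w \in s -> N w).
  by exists dv0; case: dv0 => d v /h.
pose L := nat_rect (fun _ => seq 'rV[R]_m) [::] (fun _ s => (pick s).2 :: s).
have LN k : forall w, w \in L k -> N w.
  elim: k => [//|k IHk] w; rewrite inE => /orP[/eqP->|/IHk//].
  by have := pickP (L k); case: (pick _) => d v /(_ IHk)[].
have Lmem i j : (i < j)%N -> (pick (L i)).2 \in L j.
  elim: j => // j IHj; rewrite ltnS leq_eqVlt => /orP[/eqP->|/IHj ij].
    exact: mem_head.
  by rewrite inE ij orbT.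
(* Both d and m - d are coordinates, so that comparing them forces equal positions. *)
pose f k (t : 'I_n + bool) : nat := let: (d, v) := pick (L k) in
  match t with
  | inl i => mlead (v 0 d) i
  | inr b => if b then d : nat else (m - d)%N
  end.
have [i [j [ij fij]]] := dickson f.
have := pickP (L i); have := pickP (L j); have := Lmem _ _ ij.
move: fij; rewrite /f; case: (pick (L i)) => di vi; case: (pick (L j)) => dj vj.
move=> fij /= vij /(_ (LN j))[Nj sj zj nzj minj] /(_ (LN i))[Ni _ zi nzi _].
have dE : di = dj.
  apply: val_inj; have /= h1 := fij (inr true); have /= h2 := fij (inr false).
  by have := ltn_ord di; have := ltn_ord dj; lia.
have le : (mlead (vi 0 dj)%R <= mlead (vj 0 dj)%R)%MM.
  by apply/mnm_lepP => t; have /= := fij (inl t); rewrite dE.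
rewrite {}dE in zi nzi.
pose c := (mleadc (vj 0 dj) / mleadc (vi 0 dj)) *:
  'X_[(mlead (vj 0 dj)%R - mlead (vi 0 dj)%R)%MM] : R.
have [_ _ NZ] := sN; have sS := submod_span (L j); have [_ sD sZ] := sS.
have [||l lj|nz le'] := minj (vj - c *: vi).
- by apply: submodB => //; apply: NZ.
- move=> h; apply: sj; rewrite -[vj](subrK (c *: vi)); apply: sD => //.
  by apply: sZ; apply: span_mem.
- by rewrite !mxE zj // zi // mulr0 subr0.
have := mlead_cancel nzj nzi le; rewrite !mxE in nz le'.
by move=> /(_ nz); rewrite ltNge le'.
Qed.

End Noetherian.

(** * Existence of minimal free resolutions *)

Section MinimalResolutions.
Variables (K : fieldType) (n : nat).
Local Notation R := {mpoly K[n]}.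

Lemma vcomp_sum m (g : 'I_m -> int) (v : 'rV[R]_m) :
  exists b c, v = \sum_(i < b) vcomp g ((i : nat)%:Z - c) v.
Proof.
(* All degrees occurring in v lie between -D and D - 1, hence 2D components starting in degree
   -D. *)
pose D := \max_(l < m) (msize (v 0%R l) + `|g l|)%N.
have Dl l : (msize (v 0%R l) + `|g l| <= D)%N.
  by rewrite /D (bigD1 l) //= leq_maxl.
exists (D + D)%N, D%:Z; apply/rowP => l; rewrite summxE.
under eq_bigr do rewrite mxE.
apply/mpolyP => m'; rewrite raddf_sum /=.
under eq_bigr do rewrite mcoeff_hcomp.
have [mv|] := boolP (m' \in msupp (v 0 l)); last first.
  rewrite -mcoeff_eq0 => /eqP->; rewrite big1 // => i _.
  by case: ifP.
have := Dl l; have := msize_mdeg_lt mv => h1 h2.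
have ltD : (`|((mdeg m')%:Z + g l + D%:Z)%R| < D + D)%N by lia.
rewrite (bigD1 (Ordinal ltD)) //= big1 => [|i].
  by rewrite addr0 ifT //; apply/eqP; lia.
rewrite -val_eqE /= => iD; rewrite ifF //; apply/negP => /eqP h.
by move/eqP: iD; apply; lia.
Qed.

Definition generates_mod m b (N B : set 'rV[R]_m) (X : 'M[R]_(b, m)) : Prop :=
  (forall k, N (row k X)) /\ (forall v, N v -> exists x, B (v - x *m X)).

(** Finitely many generators are replaced by their homogeneous components, which stay in N; the list
    t stores each one with its degree. *)
Lemma homogeneous_generators m g (N B : set 'rV[R]_m) :
  submod N -> vgraded g N -> submod B ->
  exists b gb (X : 'M[R]_(b, m)), mhom gb g X /\ generates_mod N B X.
Proof.
move=> sN gN sB; have [s [sNs Ns]] := noetherian sN.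
have [t [tP tN]] : exists t : seq (int * 'rV[R]_m),
    (forall zv, zv \in t -> N zv.2 /\ vcomp g zv.1 zv.2 = zv.2) /\
    N `<=` span [seq zv.2 | zv <- t].
  suff [t [tP ts]] : exists t : seq (int * 'rV[R]_m),
    (forall zv, zv \in t -> N zv.2 /\ vcomp g zv.1 zv.2 = zv.2) /\
    (forall v, v \in s -> span [seq zv.2 | zv <- t] v).
    exists t; split=> // v /Ns; apply=> //; exact: submod_span.
  elim: s sNs {Ns} => [|v s IHs] sNs; first by exists [::].
  have [|t [tP ts]] := IHs.
    by move=> w ws; apply: sNs; rewrite inE ws orbT.
  have [b [c vE]] := vcomp_sum g v.
  pose r := [seq (i%:Z - c, vcomp g (i%:Z - c) v) | i <- iota 0 b].
  exists (r ++ t); split=> [zv|w].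
    rewrite mem_cat => /orP[/mapP[i _ ->]|/tP//]; split=> /=.
      by apply: gN; apply: sNs; rewrite mem_head.
    by apply/rowP => l; rewrite !mxE hcomp_id //; apply: hcomp_is_hom.
  rewrite inE => /orP[/eqP->|/ts ws]; last first.
    move=> B' sB' h; apply: ws => // w' w't; apply: h.
    by rewrite map_cat mem_cat w't orbT.
  move=> B' [B0 BD _] h; rewrite vE; elim/big_ind: _ => // i _; apply: h.
  rewrite map_cat mem_cat; apply/orP; left.
  apply/mapP; exists ((i : nat)%:Z - c, vcomp g ((i : nat)%:Z - c) v) => //.
  by apply/mapP; exists (i : nat) => //; rewrite mem_iota /= ltn_ord.
pose X : 'M[R]_(size t, m) := \matrix_(k < size t) (nth (0, 0) t k).2.
exists (size t), (fun k : 'I_(size t) => (nth (0, 0) t k).1), X.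
have Xrow k : row k X = (nth (0, 0) t k).2 by rewrite rowK.
split.
  apply/mhomP => k l; have [_] := tP _ (mem_nth (0, 0) (ltn_ord k)).
  rewrite -Xrow => /rowP/(_ l); rewrite !mxE => <-; exact: hcomp_is_hom.
split=> [k|v /tN tv].
  by rewrite Xrow; case: (tP _ (mem_nth (0, 0) (ltn_ord k))).
have [x ->] : [set v | exists x, v = x *m X] v.
  apply: tv; first split.
  - by exists 0; rewrite mul0mx.
  - by move=> _ _ [x ->] [y ->]; exists (x + y); rewrite mulmxDl.
  - by move=> a _ [x ->]; exists (a *: x); rewrite scalemxAl.
  move=> w /mapP[zv zvt ->]; rewrite -index_mem in zvt.
  exists (delta_mx 0 (Ordinal zvt)); rewrite -rowE Xrow /= nth_index //.
  by rewrite -index_mem.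
by exists x; rewrite subrr; case: sB.
Qed.

Lemma mulmx_row' b m (k : 'I_b.+1) (x : 'rV[R]_b.+1) (X : 'M[R]_(b.+1, m)) :
  x *m X = x 0 k *: row k X + col' k x *m row' k X.
Proof.
rewrite !mulmx_sum_row (bigD1_ord k) //=; congr (_ + _).
apply: eq_bigr => i _; rewrite mxE; congr (_ *: _).
by apply/rowP => j; rewrite !mxE.
Qed.

(* In a generating family of minimal cardinality, a relation with an invertible
   coefficient would make one of the generators redundant. *)
Lemma minimal_generators m g (N B : set 'rV[R]_m) :
  submod N -> vgraded g N -> submod B -> vgraded g B ->
  exists b gb (X : 'M[R]_(b, m)), [/\ mhom gb g X, generates_mod N B X &
    forall x, B (x *m X) -> forall k, (x 0 k)@_0%MM = 0].
Proof.
move=> sN gN sB gB.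
pose P b := `[< exists gb (X : 'M[R]_(b, m)),
  mhom gb g X /\ generates_mod N B X >].
have exb : exists b, P b.
  have [b [gb [X h]]] := homogeneous_generators sN gN sB.
  by exists b; apply/asboolP; exists gb, X.
case: (ex_minnP exb) => b /asboolP[gb [X [hX [XN NX]]]] bmin.
exists b, gb, X; split=> // x Bx k; apply/eqP; apply: contraT => xk.
case: b k gb X hX XN NX bmin x Bx xk => [[]//|b] k gb X hX XN NX bmin x Bx xk.
have := bmin b; rewrite ltnn => h; suff: false by []; apply: h.
apply/asboolP; exists (gb \o lift k), (row' k X); split.
  by move=> i l m'; rewrite mxE; apply: hX.
split=> [i|v /NX[w Bw]].
  have -> : row i (row' k X) = row (lift k i) X.
    by apply/rowP => j; rewrite !mxE.
  exact: XN.
(* The component of x in the degree of generator k is still a relation, and its k-th entry is the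
   nonzero constant c. Subtracting a multiple of it from w clears the k-th coefficient. *)
pose y := vcomp gb (gb k) x; set c := (x 0 k)@_0%MM in xk.
have By : B (y *m X) by rewrite -(vcomp_mulmx _ _ hX); apply: gB.
have yk : y 0 k = c%:MP.
  rewrite mxE subrr; apply/mpolyP => m'; rewrite mcoeff_hcomp mcoeffC.
  rewrite eqz_nat mdeg_eq0; have [->|] := eqVneq; by rewrite ?mulr1 ?mulr0.
move: y By yk => y By yk.
pose z := w - (w 0 k * (c^-1)%:MP) *: y.
have zk : z 0 k = 0.
  by rewrite !mxE yk -mulrA -mpolyCM mulVf // mulr1 subrr.
exists (col' k z); have := mulmx_row' k z X; rewrite zk scale0r add0r => <-.
have -> : v - z *m X = (v - w *m X) + (w 0 k * (c^-1)%:MP) *: (y *m X).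
  by rewrite mulmxBl -scalemxAl opprB addrA addrAC.
by have [_ BD BZ] := sB; apply: BD => //; apply: BZ.
Qed.

(** This makes the next differential minimal, since its rows are syzygies of [D]. *)
Definition no_unit_syzygy a b (D : 'M[R]_(a, b)) : Prop :=
  forall x : 'rV_a, x *m D = 0 -> forall k, (x 0 k)@_0%MM = 0.

Lemma minimal_presentation m g (N : set 'rV[R]_m) :
  submod N -> vgraded g N ->
  exists b gb (X : 'M[R]_(b, m)), [/\ mhom gb g X,
    forall v, N v <-> exists x, v = x *m X & no_unit_syzygy X].
Proof.
move=> sN gN.
have [b [gb [X [hX [XN NX] Xmin]]]] :=
  minimal_generators sN gN (@submod0 _ _ _) (@vgraded0 _ _ _ g).
exists b, gb, X; split=> // v; split=> [/NX[x xE]|[x ->]].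
  by exists x; apply/eqP; rewrite -subr_eq0; apply/eqP.
exact: submod_mulmx.
Qed.

(** A differential bundled with its ranks and degrees, so that a resolution arises by iteration: the
    target of [next_stage s] is by definition the source of s. *)
Record stage := Stage {
  src : nat; src_deg : 'I_src -> int;
  tgt : nat; tgt_deg : 'I_tgt -> int;
  stage_map : 'M[R]_(src, tgt);
  stage_hom : mhom src_deg tgt_deg stage_map;
  stage_min : no_unit_syzygy stage_map
}.

Lemma next_stage_subproof (s : stage) :
  exists t : {b : nat & (('I_b -> int) * 'M[R]_(b, src s))%type},
    [/\ mhom (projT2 t).1 (@src_deg s) (projT2 t).2,
        no_unit_syzygy (projT2 t).2
      & forall v : 'rV_(src s), v *m stage_map s = 0 <->
          exists x, v = x *m (projT2 t).2].
Proof.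
have [||b [gb [X [hX XN Xmin]]]] :=
  @minimal_presentation _ (@src_deg s)
    [set v : 'rV_(src s) | v *m stage_map s = 0].
- split=> [|v w v0 w0|a v v0] /=; rewrite ?mul0mx //.
    by rewrite mulmxDl v0 w0 addr0.
  by rewrite -scalemxAl v0 scaler0.
- move=> z v /= v0; rewrite -(vcomp_mulmx _ _ (@stage_hom s)) v0.
  by apply/rowP => l; rewrite !mxE raddf0.
by exists (existT _ b (gb, X)).
Qed.

Definition next_stage (s : stage) : stage :=
  let t := cid (next_stage_subproof s) in
  @Stage _ _ (src s) (@src_deg s) _
    (let: And3 th _ _ := svalP t in th) (let: And3 _ tm _ := svalP t in tm).

Lemma next_stageP s (v : 'rV_(src s)) :
  v *m stage_map s = 0 <-> exists x, v = x *m stage_map (next_stage s).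
Proof. by have [_ _] := svalP (cid (next_stage_subproof s)); apply. Qed.

(** Minimal generators of R modulo I give F_0, a minimal presentation of the kernel of F_0 -> R/I
    gives F_1, and iterating [next_stage] gives the rest. *)
Lemma minimal_free_resolution_exists (I : set R) : is_ideal I -> graded I ->
  exists F : graded_free_sequence K n, minimal_free_resolution I F.
Proof.
move=> hI gI; have sI := submod_scalar_set hI.
have gI' := vgraded_scalar_set gI.
have [a [ga [X0 [hX0 [_ X0gen] X0min]]]] :=
  minimal_generators (@submod_setT _ _ 1) (fun _ _ _ => Logic.I) sI gI'.
have [||b [gb [X1 [hX1 X1P X1min]]]] :=
  @minimal_presentation _ ga [set v : 'rV_a | scalar_set I (v *m X0)].
- have [s0 sD sZ] := sI; split=> [|v w v0 w0|c v v0] /=.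
  + by rewrite mul0mx.
  + by rewrite mulmxDl; apply: sD.
  + by rewrite -scalemxAl; apply: sZ.
- by move=> z v /= v0; rewrite -(vcomp_mulmx _ _ hX0); apply: gI'.
pose st := nat_rect (fun=> stage) (@Stage b gb a ga X1 hX1 X1min)
  (fun _ => next_stage).
have homX0 k m : m \in msupp (X0 k 0) -> (mdeg m)%:Z = ga k.
  by move=> /hX0 <-; rewrite add0r.
exists (@GradedFreeSequence K n (fun i => tgt (st i))
  (fun i => @tgt_deg (st i)) X0 (fun i => stage_map (st i)) homX0
  (fun i => @stage_hom (st i))).
split=> /= [p|v|i v|i k l].
- have [x hx] := X0gen (\row_(_ < 1) p) Logic.I; exists x.
  by move: hx; rewrite /scalar_set /= !mxE.
- exact: X1P.
- exact: next_stageP.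
- have -> : stage_map (st i) k l = row k (stage_map (st i)) 0 l by rewrite mxE.
  case: i k l => [|i] k l.
    by apply: X0min; apply/X1P; exists (delta_mx 0 k); rewrite -rowE.
  apply: (@stage_min (st i)); apply/next_stageP.
  by exists (delta_mx 0 k); rewrite -rowE.
Qed.

End MinimalResolutions.

(** * The regularity bound *)

Section RegularityBounds.
Variables (K : fieldType) (n : nat).
Local Notation R := {mpoly K[n]}.

(** [supremum] picks a least upper bound only if there is one. It is +oo if no integer bounds the
    set, and a maximum otherwise. *)
Lemma supremums_ereal_int (A : set (\bar int)) :
  A !=set0 -> (forall x, A x -> exists z : int, x = z%:E) -> supremums A !=set0.
Proof.
move=> [x0 Ax0] Afin; have [z0 x0E] := Afin _ Ax0.
have [[M AM]|unb] := pselect (exists M : int, ubound A M%:E); last first.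
  exists +oo%E; split=> [x _|b Ab]; first exact: leey.
  case: b Ab => [M AM||Ab] //; first by exfalso; apply: unb; exists M.
  by have := Ab _ Ax0; rewrite x0E leeNy_eq.
pose P k := `[< A (z0 + k%:Z)%:E >].
have exP : exists k, P k by exists 0%N; apply/asboolP; rewrite addr0 -x0E.
have bP k : P k -> (k <= `|(M - z0)%R|)%N.
  by move=> /asboolP/AM; rewrite lee_fin; lia.
case: (ex_maxnP exP bP) => k /asboolP Ak kmax.
exists (z0 + k%:Z)%:E; split=> [x Ax|b]; last exact.
have [z xE] := Afin _ Ax; rewrite xE lee_fin.
have [zz0|z0z] := leP z z0; first by lia.
have /kmax : P `|(z - z0)%R|%N.
  apply/asboolP; rewrite gez0_abs; last by lia.
  by rewrite addrC subrK -xE.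
by lia.
Qed.

(** The existence of a minimal resolution is essential: without one, the supremum would be -oo and
    carry no information. *)
Lemma reg_quotient_reg_le (I : set R) (r : int) : is_ideal I -> graded I ->
  (reg_quotient I <= r%:E)%E -> reg_le r setT I.
Proof.
move=> hI gI; have [F minF] := minimal_free_resolution_exists hI gI.
move=> le; exists F; first exact: minimal_resolves.
move=> i k; rewrite -lerBlDr -lee_fin; apply: le_trans le.
apply: ge_supremum_Nmem; last by exists F, i, k.
apply: supremums_ereal_int; first by exists (gdeg k - i%:Z)%:E, F, i, k.
by move=> _ [F' [i' [k' [_ ->]]]]; eexists.
Qed.

Lemma reg_quotient_le (I : set R) (b : \bar int) :
  (forall (F : graded_free_sequence K n) i (k : 'I_(rk F i)),
     minimal_free_resolution I F -> ((gdeg k - i%:Z)%:E <= b)%E) ->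
  (reg_quotient I <= b)%E.
Proof.
move=> h; rewrite /reg_quotient /supremum; case: ifP => _; first exact: leNye.
(* The default value of [xget] is -oo here, which lies below any bound. *)
case: xgetP => [x _ [_ xmin]|_]; last exact: leNye.
by apply: xmin => _ [F [i [k [mF ->]]]]; apply: h.
Qed.

Lemma reg_le_minimal_gdeg (I : set R) (r : int) (F : graded_free_sequence K n)
    i (k : 'I_(rk F i)) : is_ideal I -> graded I ->
  reg_le r setT I -> minimal_free_resolution I F -> gdeg k - i%:Z <= r.
Proof.
move=> hI gI [G rG Gr] mF; have [l ->] := minimal_gdeg hI gI mF rG k.
by rewrite lerBlDr.
Qed.

Context {disp : Order.disp_t} {L : finPOrderType disp}.
Variable u : L -> R.
Hypothesis L_nonempty : (0 < #|L|)%N.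
Hypothesis u_neq0 : forall l, u l != 0.
Hypothesis u_homog : forall l, u l \is homog mdeg.
Hypothesis u_quadratic : quadratic_sequence u.
Variable r : int.
Hypothesis reg_colon : forall Sigma l,
  poset_ideal Sigma -> just_above Sigma l ->
  reg_le r setT (ideal_add (ideal_colon (U_ u Sigma) (u l)) (U_ u finset.setT)).

Local Notation UL := (U_ u finset.setT).
Let d := \max_(l : L) poly_degree (u l).
(** These ideals grow from U^(k+2), for the empty set, to U^(k+1), for the whole poset, and filter
    the quotient of the two. *)
Let M Sigma k :=
  ideal_add (ideal_mul (U_ u Sigma) (ideal_exp UL k)) (ideal_exp UL k.+2).

Let is_ideal_M Sigma k : is_ideal (M Sigma k).
Proof. by apply: is_ideal_add; [apply: is_ideal_mul|apply: is_ideal_exp]. Qed.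

Let graded_M Sigma k : graded (M Sigma k).
Proof.
by apply: graded_add; [apply: graded_mul|]; do ?apply: graded_exp;
  apply: graded_U.
Qed.

Let M_sub Sigma k : M Sigma k `<=` ideal_exp UL k.+1.
Proof.
apply: ideal_add_sub; [exact: is_ideal_exp| |exact: ideal_expS_sub].
by apply: U_mul_subset; apply: finset.subsetT.
Qed.

(** Multiplication by u_l identifies U^k/B' with this layer of the filtration, up to a shift by the
    degree of u_l, which is at most d. *)
Lemma reg_le_step Sigma l k (r' : int) (B' : set R) :
  reg_le r' (ideal_exp UL k) B' ->
  (forall a, ideal_exp UL k a -> M Sigma k (u l * a) <-> B' a) ->
  reg_le (r' + d%:Z) (M (l |: Sigma)%SET k) (M Sigma k).
Proof.
move=> regB' MB'; have hl := homog_is_hom (u_homog l).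
apply: (@reg_le_mono _ _ (r' + (poly_degree (u l))%:Z)).
  by rewrite lerD2l lez_nat /d (bigD1 l) //= leq_maxl.
apply: (reg_le_scale hl (@is_ideal_M _ _) _ _ MB' (is_ideal_exp _ _) regB').
- move=> a ka; apply: ideal_addl; first exact: is_ideal_exp.
  by apply: ideal_mul_mem => //; apply: U_mem; rewrite !inE eqxx.
- move=> _ [p [q [Sp kq ->]]].
  have [b [z [Sb kz ->]]] := U_mul_setU1 (is_ideal_exp _ _) Sp.
  exists z => //; exists b, q; split=> //; ring.
Qed.

(** For the whole poset the quotient is zero, and each element removed from the poset ideal adds one
    layer by the horseshoe lemma. *)
Lemma reg_le_descent k (r' : int) :
  (forall Sigma l, poset_ideal Sigma -> just_above Sigma l ->
     reg_le r' (M (l |: Sigma)%SET k) (M Sigma k)) ->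
  forall Sigma, poset_ideal Sigma -> reg_le r' (ideal_exp UL k.+1) (M Sigma k).
Proof.
move=> step Sigma; pose P S := reg_le r' (ideal_exp UL k.+1) (M S k).
apply: (@poset_ideal_ind _ _ P) => [|{}Sigma l hS hl]; rewrite /P.
  have -> : M finset.setT k = ideal_exp UL k.+1.
    apply/seteqP; split; first exact: M_sub.
    exact: (ideal_addl (is_ideal_exp _ _)).
  exact: (reg_le_refl _ (is_ideal_exp _ _)).
move=> IH; apply: (reg_le_trans (is_ideal_exp _ _) (@is_ideal_M _ _)
  (@is_ideal_M _ _) (@graded_M _ _) (@M_sub _ _) _ IH (step _ _ hS hl)).
apply: (ideal_add_sub (@is_ideal_M _ _)); last first.
  exact: (ideal_addr (is_ideal_mul _ _)).
move=> x hx; apply: (ideal_addl (is_ideal_exp _ _)).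
exact: (U_mul_subset (finset.subsetUr _ _) hx).
Qed.

(** By [colon_U_expS], the layers for k + 1 are, up to a shift by at most d, quotients U^(k+1) /
    [M Theta k], which the induction hypothesis covers. For k = 0 they are the quotients of R in
    [reg_colon]. *)
Lemma reg_le_exp_M k Sigma : poset_ideal Sigma ->
  reg_le (r + (d * k.+1)%N%:Z) (ideal_exp UL k.+1) (M Sigma k).
Proof.
elim: k Sigma => [|k IHk] Sigma; apply: reg_le_descent => {}Sigma l hS hl.
  rewrite muln1; apply: (@reg_le_step Sigma l 0 r _ (reg_colon hS hl)) => a _.
  exact: colon_U_exp0.
have [Theta hT ThetaP] := colon_U_expS u_quadratic hS hl.
rewrite mulnS addnC PoszD addrA; apply: (reg_le_step (IHk Theta hT)) => a ka.
exact: ThetaP.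
Qed.

Lemma reg_le_exp k : reg_le (r + (d * k)%N%:Z) setT (ideal_exp UL k.+1).
Proof.
elim: k => [|k IHk].
  rewrite muln0 addr0 ideal_exp1; last exact: is_ideal_U.
  have [|l hl] := @exists_just_above _ L finset.set0.
    by apply/eqP => /setP e; case/card_gt0P: L_nonempty => x _;
      have := e x; rewrite !inE.
  (* As R is a domain, (0 : u_l) is zero, and the ideal in [reg_colon] reduces to U. *)
  have := reg_colon (poset_ideal0) hl; congr reg_le; apply/seteqP; split.
    apply: (ideal_add_sub (is_ideal_U _ _)) => //.
    move=> x; rewrite /ideal_colon /= U_set0 => /eqP.
    rewrite mulf_eq0 (negPf (u_neq0 l)) orbF => /eqP->.
    by apply: is_ideal0; apply: is_ideal_U.
  by apply: ideal_addr; apply: is_ideal_colon; apply: is_ideal_U.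
have M0 : M finset.set0 k = ideal_exp UL k.+2.
  apply/seteqP; split; last exact: (ideal_addr (is_ideal_mul _ _)).
  apply: (ideal_add_sub (is_ideal_exp _ _)) => //.
  apply: (ideal_mul_sub (is_ideal_exp _ _)).
  move=> x y; rewrite U_set0 => -> _; rewrite mul0r.
  by apply: is_ideal0; apply: is_ideal_exp.
have := reg_le_exp_M k poset_ideal0; rewrite M0.
apply: (reg_le_trans (is_ideal_setT _) (is_ideal_exp _ _) (is_ideal_exp _ _)).
- by apply: graded_exp; apply: graded_U.
- by [].
- exact: ideal_expS_sub.
- by apply: reg_le_mono IHk; rewrite lerD2l lez_nat leq_mul2l leqnSn orbT.
Qed.

End RegularityBounds.

Theorem theorem2p8 (K : fieldType) (n : nat) (disp : Order.disp_t)
    (L : finPOrderType disp) (u : L -> {mpoly K[n]})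
    (L_nonempty : (0 < #|L|)%N)
    (u_neq0 : forall l, u l != 0%R)
    (u_homog : forall l, u l \is homog mdeg)
    (u_degree : forall l, (0 < poly_degree (u l))%N)
    (u_quadratic : quadratic_sequence u)
    (s : nat) (s_ge1 : (1 <= s)%N) :
  (reg_quotient (ideal_exp (U_ u finset.setT) s) <=
   ((\max_(l : L) poly_degree (u l)) * (s - 1))%N%:Z%:E +
   \big[Order.max/-oo]_(q : {set L} * L
                        | poset_ideal q.1 && inside_or_just_above q.1 q.2)
      reg_quotient
        (ideal_add (ideal_colon (U_ u q.1) (u q.2)) (U_ u finset.setT)))%E.
Proof.
set D := (_ * _)%N; set M := \big[_/_]_(q | _) _.
have regM Sigma l : poset_ideal Sigma -> just_above Sigma l ->
    (reg_quotient (ideal_add (ideal_colon (U_ u Sigma) (u l))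
       (U_ u finset.setT)) <= M)%E.
  move=> hS hl; rewrite /M.
  apply: (le_bigmax_cond _ (j := (Sigma, l))
    (P := fun q => poset_ideal q.1 && inside_or_just_above q.1 q.2)).
  by rewrite hS /inside_or_just_above hl orbT.
have gU Sigma : graded (U_ u Sigma) by apply: graded_U.
(* Any integer r above M is allowed here, as M itself may be infinite. *)
have bound (r : int) (F : graded_free_sequence K n) i (k : 'I_(rk F i)) :
    (M <= r%:E)%E ->
    minimal_free_resolution (ideal_exp (U_ u finset.setT) s) F ->
    gdeg k - i%:Z <= D%:Z + r.
  move=> Mr; apply: reg_le_minimal_gdeg.
  - exact: is_ideal_exp.
  - exact: graded_exp.
  rewrite addrC /D -(prednK s_ge1) subn1; apply: reg_le_exp => // Sigma l hS hl.
  have iU : is_ideal (U_ u Sigma) := is_ideal_U u Sigma.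
  apply: reg_quotient_reg_le; last exact: le_trans (regM _ _ hS hl) Mr.
  - by apply: is_ideal_add; [exact: is_ideal_colon|exact: is_ideal_U].
  - apply: graded_add => //; apply: (graded_colon (homog_is_hom (u_homog l))).
    exact: gU.
apply: reg_quotient_le => F i k mF; move: M regM bound => M _ bound.
case: M bound => [r| |] bound.
- by rewrite lee_fin; apply: bound mF.
- exact: leey.
(* If M is -oo, [bound] holds for every integer r. This r would give gdeg k - i <= gdeg k - i - 1,
   so there is no generator at all. *)
- exfalso; have := bound (gdeg k - i%:Z - D%:Z - 1) F i k (leNye _) mF.
  by lia.
Qed.
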